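(* Consider the system $\dot x=f(t,x)$ evolving on a state space $D\subseteq\mathbb{R}^n$. Let $p\in\{1,2,\infty\}$ and let $\mu_p$ be the matrix measure induced by the $L_p$ norm. Suppose that for some $\alpha\in[1,n)$ there exists $\eta>0$ such that $$\mu_p(J_f^{[\alpha]}(t,x))\le-\eta<0\quad\text{for all } t\ge 0,\ x\in D.$$ Then there exists a minimal real value $\alpha^*\in[1,\alpha]$ such that the system is $\beta$ contracting w.r.t. the norm $|\cdot|_p$ for any $\beta\in(\alpha^*,n]$.
   Context: **System.** $f$ is $C^1$, and $D\subseteq\mathbb{R}^n$ is an invariant set of $\dot x=f(t,x)$ (solutions starting in $D$ at time $0$ remain in $D$ for all $t\ge0$). $J_f(t,x):=\frac{\partial}{\partial x}f(t,x)$. **Compounds.** For a matrix $A$, $A^{(k)}$ is the matrix of all $k\times k$ minors of $A$ in lexicographic order. For $A\in\mathbb{R}^{n\times n}$ and $k\in\{1,\dots,n\}$, $A^{[k]}:=\frac{d}{d\varepsilon}(I+\varepsilon A)^{(k)}|_{\varepsilon=0}$. For a non-integer $\alpha=k+s\in(1,n)$, $k\in\{1,\dots,n-1\}$, $s\in(0,1)$, the $\alpha$ multiplicative compound of a non-singular $B$ is $B^{(\alpha)}:=(B^{(k)})^{1-s}\otimes(B^{(k+1)})^s$, where $\otimes$ is the Kronecker product and real powers are principal powers (defined via the Jordan form, with $a^\beta=|a|^\beta e^{j\beta\theta(a)}$, $\theta(a)\in(-\pi,\pi]$ for scalars). The $\alpha$ additive compound is $A^{[\alpha]}:=\frac{d}{d\varepsilon}(I+\varepsilon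 A)^{(\alpha)}|_{\varepsilon=0}$. For integer $\alpha=k$, $A^{[\alpha]}$ is the standard $A^{[k]}$. **Matrix measure.** $\mu_p(A):=\lim_{\varepsilon\downarrow0}\frac{\|I+\varepsilon A\|_p-1}{\varepsilon}$, where $\|\cdot\|_p$ is the matrix norm induced by the $L_p$ vector norm $|\cdot|_p$ (for square matrices of any size). **$\beta$ contraction.** For real $\beta\in[1,n]$, the system is $\beta$ contracting w.r.t. $|\cdot|_p$ if there is $\eta'>0$ such that $\mu_p(J_f^{[\beta]}(t,x))\le-\eta'<0$ for all $t\ge0$, $x\in D$. *)

(* Defs.v *)
From HB Require Import structures.
From mathcomp Require Import all_boot all_order all_algebra.
From mathcomp Require Import all_classical all_reals all_analysis.
From mathcomp Require Import complex.
Set Implicit Arguments.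
Unset Strict Implicit.
Unset Printing Implicit Defensive.
Import Order.TTheory GRing.Theory Num.Theory.
Import numFieldTopology.Exports numFieldNormedType.Exports.
Local Open Scope classical_set_scope.
Local Open Scope ring_scope.

(* A real matrix is regarded as a complex one for everything that concerns
   compounds, because principal real powers are complex in general. *)

Section Powers.
Context {R : realType}.
Implicit Types (a : R[i]) (b : R).

(* Principal argument, in ]-pi, pi] when a != 0. *)
Definition carg a : R :=
  if 0 <= complex.Im a then acos (complex.Re a / Normc.normc a)
  else - acos (complex.Re a / Normc.normc a).

Definition cpow a b : R[i] :=
  ((Normc.normc a `^ b)%:C * (cos (b * carg a) +i* sin (b * carg a)))%C.

Definition gbinom b (m : nat) : R := (\prod_(l < m) (b - l%:R)) / m`!%:R.

Definition jordan_block m a : 'M[R[i]]_m :=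
  \matrix_(i, j) (if i == j then a else if i.+1 == j :> nat then 1 else 0).

(* The value of z ^ b at a Jordan block: the m-th superdiagonal carries
   (1 / m!) (d/dz)^m z ^ b = 'C(b, m) z ^ (b - m) at z = a. *)
Definition jordan_block_pow b m a : 'M[R[i]]_m :=
  \matrix_(i, j)
    (if (i <= j)%N then (gbinom b (j - i))%:C%C * cpow a (b - (j - i)%:R)
     else 0).

(* B = P J P^-1 with J in Jordan form, and X = P J^b P^-1.  The matrices P and
   Q = P^-1 are typed as rectangular ones since N and the sum of the sizes of
   the blocks are only provably equal. *)
Definition is_mxpow b N (B X : 'M[R[i]]_N) : Prop :=
  exists (q : nat) (lam : 'I_q -> R[i]) (sz : 'I_q -> nat)
         (P : 'M[R[i]]_(N, \sum_(i < q) sz i))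
         (Q : 'M[R[i]]_(\sum_(i < q) sz i, N)),
    [/\ forall i, (0 < sz i)%N,
        P *m Q = 1%:M, Q *m P = 1%:M,
        B = P *m (\mxdiag_(i < q) jordan_block (sz i) (lam i)) *m Q &
        X = P *m (\mxdiag_(i < q) jordan_block_pow b (sz i) (lam i)) *m Q].

(* Meaningful for a nonsingular B, for which exactly one X is suitable. *)
Definition mxpow b N (B : 'M[R[i]]_N) : 'M[R[i]]_N :=
  xget 0 [set X | is_mxpow b B X].

End Powers.

Section Compounds.
Context {R : realType}.

(* Row-major indexing of pairs: mxvec_index i k has value i * n + k. *)
Definition kron_index m n (r : 'I_(m * n)) : 'I_m * 'I_n :=
  enum_val (cast_ord (esym (mxvec_cast m n)) r).

Definition kron m1 n1 m2 n2 (A : 'M[R[i]]_(m1, n1)) (B : 'M[R[i]]_(m2, n2)) :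
    'M[R[i]]_(m1 * m2, n1 * n2) :=
  \matrix_(r, c)
    (A (kron_index r).1 (kron_index c).1 * B (kron_index r).2 (kron_index c).2).

(* The k-subsets of 'I_n, as increasing k-tuples; these tuples are ordered
   lexicographically, and Order.enum_val enumerates them in that order. *)
Definition incr_tuples n k : {set k.-tuplelexi 'I_n} :=
  [set t : k.-tuplelexi 'I_n | sorted ltn (map val (t : k.-tuple 'I_n))].

Definition minor_index n k (I : 'I_#|incr_tuples n k|) : k.-tuple 'I_n :=
  Order.enum_val I.

Definition compound k n (A : 'M[R[i]]_n) : 'M[R[i]]_#|incr_tuples n k| :=
  \matrix_(I, J) \det (mxsub (tnth (minor_index I)) (tnth (minor_index J)) A).

(* The (k + s)-th multiplicative compound, for 0 < s < 1. *)
Definition frac_compound k (s : R) n (B : 'M[R[i]]_n) :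
    'M[R[i]]_(#|incr_tuples n k| * #|incr_tuples n k.+1|) :=
  kron (mxpow (1 - s) (compound k B)) (mxpow s (compound k.+1 B)).

(* Entrywise derivative at 0 of a complex matrix function of a real variable. *)
Definition mxderiv0 N (F : R -> 'M[R[i]]_N) : 'M[R[i]]_N :=
  \matrix_(i, j)
    (derive1 (fun e => complex.Re (F e i j)) 0 +i*
     derive1 (fun e => complex.Im (F e i j)) 0)%C.

Definition perturb n (A : 'M[R[i]]_n) (e : R) : 'M[R[i]]_n :=
  1%:M + e%:C%C *: A.

(* The alpha additive compound, with its size, which depends on alpha. *)
Definition add_compound (alpha : R) n (A : 'M[R[i]]_n) :
    {N : nat & 'M[R[i]]_N} :=
  let k := Num.truncn alpha in
  let s := alpha - k%:R in
  if s == 0 then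
    existT _ _ (mxderiv0 (fun e => compound k (perturb A e)))
  else
    existT _ _ (mxderiv0 (fun e => frac_compound k s (perturb A e))).

End Compounds.

Section Measure.
Context {R : realType}.

(* The value at p = -oo is irrelevant. *)
Definition vnorm (p : \bar R) N (v : 'cV[R[i]]_N) : R :=
  match p with
  | r%:E => (\sum_(i < N) Normc.normc (v i 0) `^ r) `^ r^-1
  | +oo%E => \big[Num.max/0]_(i < N) Normc.normc (v i 0)
  | -oo%E => 0
  end.

Definition mxnorm p N (A : 'M[R[i]]_N) : R :=
  sup [set vnorm p (A *m v) | v in [set v : 'cV[R[i]]_N | vnorm p v = 1]].

Definition mxmeasure p N (A : 'M[R[i]]_N) : R :=
  lim ((mxnorm p (perturb A e) - 1) / e @[e --> 0^'+]).

End Measure.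

Section Systems.
Context {R : realType} {n : nat}.
Implicit Types (f : R -> 'cV[R]_n -> 'cV[R]_n) (D : set 'cV[R]_n).

(* f is C^1 on an open neighbourhood of [0, +oo[ x D. *)
Definition C1_system f D : Prop :=
  let F := fun z : R * 'cV[R]_n => f z.1 z.2 in
  exists U : set (R * 'cV[R]_n),
    [/\ open U,
        (forall t x, 0 <= t -> D x -> U (t, x)),
        (forall z, U z -> differentiable F z) &
        forall z v, U z -> {for z, continuous (fun y => 'd F y v)}].

Definition solution f (T : R) (x : R -> 'cV[R]_n) : Prop :=
  {within `[0, T[, continuous x} /\
  forall t, 0 < t < T -> is_derive t (1 : R) x (f t (x t)).

Definition invariant_set f D : Prop :=
  forall (T : R) (x : R -> 'cV[R]_n),
    solution f T x -> D (x 0) -> forall t, 0 <= t < T -> D (x t).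

Definition Jac f (t : R) (x : 'cV[R]_n) : 'M[R]_n :=
  \matrix_(i, j) 'D_(delta_mx j 0) (fun y : 'cV[R]_n => f t y i 0) x.

(* The matrix measure, for the norm of index p, of the alpha additive compound
   of the Jacobian. *)
Definition measure_Jac_compound f (p : \bar R) (alpha t : R) x : R :=
  mxmeasure p
    (projT2 (add_compound alpha (map_mx (real_complex R) (Jac f t x)))).

Definition contracting f D (p : \bar R) (beta : R) : Prop :=
  exists2 eta : R, 0 < eta &
    forall t x, 0 <= t -> D x -> measure_Jac_compound f p beta t x <= - eta.

End Systems.

(* Main.v *)
Require Import Defs.
From HB Require Import structures.
From mathcomp Require Import all_boot all_order all_algebra.
From mathcomp Require Import all_classical all_reals all_analysis.
From mathcomp Require Import complex perm.
From mathcomp Require Import zify ring lra.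
Set Implicit Arguments.
Unset Strict Implicit.
Unset Printing Implicit Defensive.
Import Order.TTheory GRing.Theory Num.Theory.
Import numFieldTopology.Exports numFieldNormedType.Exports.
Local Open Scope classical_set_scope.
Local Open Scope ring_scope.

(**
  Write [g k] for the matrix measure of [A^[k]].  The set of the admissible
  values of [astar] contains its infimum, so that it suffices to show that
  contraction at [alpha] implies contraction at every [beta] in ]alpha, n].

  For [alpha = k + s] the additive compound is the Kronecker sum of
  [(1 - s) A^[k]] and [s A^[k+1]], because [z^b] has derivative [b] at [1].
  The p-norm of a Kronecker product is the product of the p-norms, hence its
  measure is [(1 - s) g k + s g (k+1)].  It then suffices to prove that
  [g k / k] is nonincreasing, since this property passes to the piecewise
  linear interpolation of [g].

  Adding up the Laplace expansions of a minor of [1 + e A] along all its rows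
  and differentiating at [e = 0] gives [k A^[k+1] = C^T (1 (x) A^[k]) C], where
  [C] sends the basis vector of [I] to the sum over [c] of (-1)^c times the
  basis vector of [(I_c, I minus I_c)].  In this sum all pairs
  [(I_c, I minus I_c)] are distinct, so [C] multiplies p-norms by
  [(k+1)^(1/p)], whereas [C^T / (k+1)] multiplies them by at most
  [(k+1)^(-1/p)] by the power mean inequality.  Thus
  [1 + e k/(k+1) A^[k+1]] has at most the norm of [1 + e A^[k]].
*)

(** * Jordan normal form *)

(** The delicate point is the derivative of the fractional compound at [e = 0]. [mxpow] picks some
    Jordan decomposition, separately for each [e]: as [e] tends to 0 the block structure may jump
    and the bases may become arbitrarily ill conditioned, so [P J^b P^-1] cannot be differentiated
    factor by factor. Instead the matrix [B = 1 + E] is fixed, and the path [Y t = (1 + t E)^b] from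
    [1] to [B^b] is written in the chosen basis. It solves [(1 + t E) Y' = b E Y], an equation
    without any trace of the basis, and an a priori estimate for its solutions gives
    [B^b = 1 + b E + O(|E|^2)] with uniform constants. Accordingly all derivatives at 0 are handled
    as expansions with a quadratic remainder, a form that is stable under sums, products,
    determinants and, by this estimate, principal powers. The factor [k] in the Laplace identity
    arises as [(k + 1) - 1]: there is one copy of the derivative per row, and the differentiated
    entries account for one of them. *)

Section Jordan.
Variable F : closedFieldType.

Definition shift_mx m : 'M[F]_m := \matrix_(i, j) (i.+1 == j :> nat)%:R.

Lemma mx_neq0P m n (M : 'M[F]_(m, n)) : M != 0 -> exists i j, M i j != 0.
Proof.
move=> M0; have [/existsP[i /existsP[j Mij]]|] := boolP [exists i, exists j, M i j != 0].
  by exists i, j.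
move=> /existsPn H; case/eqP: M0; apply/matrixP => i j; rewrite mxE.
by have /existsPn/(_ j)/negPn/eqP := H i.
Qed.

(* Write the minimal polynomial as (X - a)^(m+1) q with q(a) != 0; then v and w
   are a row and a column in the image of q(A). *)
Lemma jordan_chain n (A : 'M[F]_n.+1) :
  exists a m (v : 'rV_n.+1) (w : 'cV_n.+1),
    [/\ v *m (A - a%:M) ^+ m.+1 = 0, (A - a%:M) ^+ m.+1 *m w = 0 &
        (v *m (A - a%:M) ^+ m *m w) 0 0 != 0].
Proof.
set p := mxminpoly A.
have p0 : p != 0 by rewrite monic_neq0 ?mxminpoly_monic.
have [a pa] : exists a, root p a.
  apply/closed_rootP; rewrite size_mxminpoly eqSS -lt0n.
  exact: mxminpoly_nonconstant.
have [m [q nqa Dp]] := multiplicity_XsubC p a.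
rewrite p0 /= in nqa.
have XaE k : horner_mx A (('X - a%:P) ^+ k) = (A - a%:M) ^+ k.
  by rewrite rmorphXn rmorphB /= horner_mx_X horner_mx_C.
case: m Dp => [|m] Dp.
  by move: pa; rewrite Dp expr0 mulr1 (negPf nqa).
pose Z := horner_mx A q.
have NZ : (A - a%:M) ^+ m.+1 *m Z = 0.
  rewrite -XaE mulmxE -rmorphM mulrC -Dp; exact: mx_root_minpoly.
have ZN : Z *m (A - a%:M) ^+ m.+1 = 0.
  rewrite -XaE mulmxE -rmorphM -Dp; exact: mx_root_minpoly.
have : Z *m (A - a%:M) ^+ m *m Z != 0.
  rewrite -XaE !mulmxE -!rmorphM /= -dvd_mxminpoly -/p Dp.
  have nz1 : ('X - a%:P) ^+ m != 0 by rewrite expf_neq0 ?polyXsubC_eq0.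
  rewrite exprS mulrA [in X in _ %| X]mulrAC dvdp_mul2r // dvdp_mul2l.
    by rewrite dvdp_XsubCl.
  by apply: contraNneq nqa => ->; rewrite root0.
case/mx_neq0P => i [j Hij].
exists a, m, (delta_mx 0 i *m Z), (Z *m delta_mx j 0); split.
- by rewrite -mulmxA ZN mulmx0.
- by rewrite mulmxA NZ mul0mx.
- have eM M : (delta_mx 0 i *m M *m delta_mx j 0 : 'M[F]_1) 0 0 = M i j.
    by rewrite -rowE -colE !mxE.
  by rewrite !mulmxA -2!(mulmxA (delta_mx 0 i)) eM.
Qed.

(** [col_base E] has a left inverse and [row_base E] a right inverse; cancelling both from
    [L K L K = L K] leaves [K L = 1]. *)
Lemma idempotent_split n (E : 'M[F]_n) : E *m E = E ->
  exists r (L : 'M[F]_(n, r)) (K : 'M[F]_(r, n)),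
    [/\ r = \rank E, E = L *m K & K *m L = 1%:M].
Proof.
move=> EE; exists (\rank E), (col_base E), (row_base E); split=> //.
  by rewrite mulmx_base.
have gen r (L : 'M[F]_(n, r)) (K : 'M[F]_(r, n)) (B : 'M[F]_(r, n)) (C : 'M[F]_(n, r)) :
    B *m L = 1%:M -> K *m C = 1%:M -> L *m K *m (L *m K) = L *m K -> K *m L = 1%:M.
  move=> BL KC /(congr1 (fun M => B *m M *m C)) /=.
  by rewrite !mulmxA BL !mul1mx -mulmxA KC mulmx1.
have [B BL] := row_fullP (col_base_full E).
have [C KC] := row_freeP (row_base_free E).
by apply: gen BL KC _; rewrite mulmx_base.
Qed.

(* The blocks of A = sum_x P_x (a_x + S) Q_x, as tuples (m_x, (a_x, P_x, Q_x)). *)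
Definition chain_block n := {m : nat & (F * 'M[F]_(n, m) * 'M[F]_(m, n))%type}.

Definition bval n (x : chain_block n) : F := (projT2 x).1.1.
Definition bcol n (x : chain_block n) : 'M[F]_(n, projT1 x) := (projT2 x).1.2.
Definition brow n (x : chain_block n) : 'M[F]_(projT1 x, n) := (projT2 x).2.

Lemma shift_mulE m p (X : 'M[F]_(m, p)) i j :
  (shift_mx m *m X) i j = if insub i.+1 is Some k then X k j else 0.
Proof.
rewrite mxE; case: insubP => [k _ ki|Hi].
  rewrite (bigD1 k) //= big1 ?addr0 => [|l nl]; first by rewrite mxE ki eqxx mul1r.
  rewrite mxE; case: eqP => [E|]; last by rewrite mul0r.
  by case/eqP: nl; apply: val_inj; rewrite /= ki -E.
rewrite big1 // => l _; rewrite mxE; case: eqP => [E|]; last by rewrite mul0r.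
by rewrite E ltn_ord in Hi.
Qed.

(* The rows v N^i and the columns N^(m-i) w have an invertible triangular Gram
   matrix, so they split off a Jordan block together with a complement. *)
Lemma jordan_split n (A : 'M[F]_n.+1) :
  exists m a (U : 'M[F]_(m.+1, n.+1)) (V : 'M[F]_(n.+1, m.+1)),
    [/\ U *m V = 1%:M, A *m V = V *m (a%:M + shift_mx m.+1) &
        U *m A = (a%:M + shift_mx m.+1) *m U].
Proof.
have [a [m [v [w [vN Nw vw]]]]] := jordan_chain A.
set N := A - a%:M in vN Nw vw.
have vN' k : (m < k)%N -> v *m N ^+ k = 0.
  by move=> mk; rewrite -(subnKC mk) exprD -mulmxE mulmxA vN mul0mx.
have Nw' k : (m < k)%N -> N ^+ k *m w = 0.
  by move=> mk; rewrite -(subnK mk) exprD -mulmxE -mulmxA Nw mulmx0.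
pose U : 'M[F]_(m.+1, n.+1) := \matrix_(i < m.+1) (v *m N ^+ i).
pose W : 'M[F]_(n.+1, m.+1) := (\matrix_(j < m.+1) (N ^+ (m - j) *m w)^T)^T.
have UN : U *m N = shift_mx m.+1 *m U.
  apply/matrixP => i j; rewrite shift_mulE.
  have -> : (U *m N) i j = (v *m N ^+ i.+1) 0 j.
    rewrite exprSr -mulmxE mulmxA !mxE; apply: eq_bigr => k _; congr (_ * _).
    by rewrite mxE.
  case: insubP => [k _ ki|Hi]; first by rewrite -ki [RHS]mxE.
  by rewrite vN' ?mxE // ltnNge; apply: contra Hi; rewrite ltnS => ->.
have NW : N *m W = W *m shift_mx m.+1.
  apply/matrixP => i j; have -> : (N *m W) i j = (N ^+ (m - j).+1 *m w) i 0.
    rewrite exprS -mulmxE -mulmxA [LHS]mxE [RHS]mxE; apply: eq_bigr => k _.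
    by congr (_ * _); rewrite !mxE.
  case: j => [[|j] Hj] /=; rewrite [RHS]mxE.
    by rewrite subn0 Nw' // mxE big1 // => k _; rewrite [shift_mx _ _ _]mxE /= mulr0.
  rewrite (bigD1 (Ordinal (ltnW Hj))) //= big1 => [|k nk]; last first.
    rewrite [shift_mx _ _ _]mxE eqSS; case: eqP; last by rewrite mulr0n mulr0.
    by move=> E; case/eqP: nk; apply: val_inj.
  by rewrite addr0 subnSK // [shift_mx _ _ _]mxE eqxx mulr1 [W _ _]mxE [in RHS]mxE [in RHS]mxE.
pose G := U *m W.
have SG : shift_mx m.+1 *m G = G *m shift_mx m.+1.
  by rewrite mulmxA -UN -mulmxA NW mulmxA.
have GE i j : G i j = (v *m N ^+ (i + (m - j)) *m w) 0 0.
  rewrite exprD -mulmxE mulmxA -(mulmxA _ _ w) [LHS]mxE [RHS]mxE.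
  by apply: eq_bigr => k _; rewrite !mxE.
(* All diagonal entries equal [v N^m w], which is nonzero; below the diagonal the exponent exceeds
   [m], and that power of [N] kills [v]. *)
have Gu : G \in unitmx.
  rewrite unitmxE -det_tr det_trig.
    rewrite unitfE; apply/prodf_neq0 => i _; rewrite mxE GE subnKC //.
    by rewrite -ltnS.
  apply/is_trig_mxP => i j ij; rewrite mxE GE vN' ?mul0mx ?mxE //.
  by have := ltn_ord i; lia.
(* [G] commutes with the shift, hence so does its inverse, and correcting [W] by it preserves the
   intertwining relation with [A]. *)
have SGi : shift_mx m.+1 *m invmx G = invmx G *m shift_mx m.+1.
  by rewrite -[LHS]mul1mx -(mulVmx Gu) -mulmxA (mulmxA G) -SG -mulmxA mulmxV // mulmx1.
exists m, a, U, (W *m invmx G); split.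
- by rewrite mulmxA mulmxV.
- rewrite -[A](subrK a%:M) -/N mulmxDl mulmxA NW -mulmxA SGi mulmxA [RHS]mulmxDr.
  by rewrite mul_scalar_mx mul_mx_scalar addrC scalemxAl mulmxA.
- have -> : A = N + a%:M by rewrite subrK.
  by rewrite mulmxDr UN mulmxDl addrC mul_scalar_mx mul_mx_scalar.
Qed.

Definition block0 n : chain_block n := existT _ 0 (0, 0, 0).

Definition lift_block n r (L : 'M[F]_(n, r)) (K : 'M[F]_(r, n)) (x : chain_block r) :
    chain_block n :=
  existT _ (projT1 x) (bval x, L *m bcol x, brow x *m K).

(** Strong induction on the size. After one block is split off, the complementary projection
    [1 - V U] commutes with [A]; factored as [L K], it compresses [A] to the smaller matrix [K A L],
    whose blocks are lifted back through [L] and [K]. *)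
Lemma jordan_blocks n (A : 'M[F]_n) : exists s : seq (chain_block n),
  [/\ \sum_(x <- s) bcol x *m brow x = 1%:M,
      forall i, (i < size s)%N -> let x := nth (block0 n) s i in
        [/\ (0 < projT1 x)%N, brow x *m bcol x = 1%:M &
            A *m bcol x = bcol x *m ((bval x)%:M + shift_mx _)] &
      forall i j, (i < size s)%N -> (j < size s)%N -> i != j ->
        brow (nth (block0 n) s i) *m bcol (nth (block0 n) s j) = 0].
Proof.
elim/ltn_ind: n A => -[_ A|n IH A].
  by exists [::]; split=> //; rewrite big_nil; apply/matrixP => -[].
have [m [a [U [V [UV AV UA]]]]] := jordan_split A.
have EE : (1%:M - V *m U) *m (1%:M - V *m U) = 1%:M - V *m U.
  rewrite mulmxBl mul1mx mulmxBr mulmx1 mulmxA -(mulmxA V) UV mulmx1.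
  by rewrite subrr subr0.
have UE : U *m (1%:M - V *m U) = 0 by rewrite mulmxBr mulmx1 mulmxA UV mul1mx subrr.
have EV : (1%:M - V *m U) *m V = 0 by rewrite mulmxBl mul1mx -mulmxA UV mulmx1 subrr.
have [r [L [K [Er ELK KL]]]] := idempotent_split EE.
(* The rank drops because the nonzero matrix [U] annihilates [1 - V U]. *)
have rn : (r < n.+1)%N.
  rewrite Er ltn_neqAle rank_leq_row andbT; apply/negP => rE.
  have {rE}/row_freeP[X EX] : row_free (1%:M - V *m U) by [].
  have U0 : U = 0 by rewrite -[U]mulmx1 -EX mulmxA UE mul0mx.
  by have /matrixP/(_ 0 0)/eqP := UV; rewrite U0 mul0mx !mxE eq_sym oner_eq0.
have UL : U *m L = 0 by rewrite -[L]mulmx1 -KL !mulmxA -(mulmxA U) -ELK UE mul0mx.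
have KV : K *m V = 0 by rewrite -[K]mul1mx -KL -!mulmxA (mulmxA L) -ELK EV mulmx0.
have AL : A *m L = L *m (K *m A *m L).
  rewrite !mulmxA -ELK mulmxBl mul1mx mulmxBl -(mulmxA V) UA mulmxA -AV.
  by rewrite -!mulmxA UL !mulmx0 subr0.
have [s [s1 sJ sO]] := IH r rn (K *m A *m L).
exists (existT _ m.+1 (a, V, U) :: map (lift_block L K) s); split.
- rewrite big_cons big_map /bcol /brow /=.
  rewrite -[X in V *m U + X = _]/(\sum_(x <- s) L *m bcol x *m (brow x *m K)).
  under eq_bigr do rewrite mulmxA -(mulmxA L).
  by rewrite -mulmx_suml -mulmx_sumr s1 mulmx1 -ELK addrC subrK.
- case=> [|i]; rewrite /= ?size_map ltnS => Hi; first by split.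
  rewrite (nth_map (block0 r)) //; have [pos QP JP] := sJ i Hi.
  split=> //; rewrite /brow /bcol /bval /=.
    by rewrite mulmxA -(mulmxA _ K) KL mulmx1.
  by rewrite mulmxA AL -mulmxA JP mulmxA.
- case=> [|i] [|j]; rewrite /= ?size_map ?ltnS ?eqSS => Hi Hj nij //.
  + by rewrite (nth_map (block0 r)) // /brow /bcol /= mulmxA UL mul0mx.
  + by rewrite (nth_map (block0 r)) // /brow /bcol /= -mulmxA KV mulmx0.
  + rewrite !(nth_map (block0 r)) // /brow /bcol /= mulmxA -(mulmxA _ K) KL mulmx1.
    exact: sO.
Qed.

Lemma jordan_exists n (A : 'M[F]_n) :
  exists q (lam : 'I_q -> F) (sz : 'I_q -> nat)
         (P : 'M[F]_(n, \sum_(i < q) sz i)) (Q : 'M[F]_(\sum_(i < q) sz i, n)),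
    [/\ forall i, (0 < sz i)%N, P *m Q = 1%:M, Q *m P = 1%:M &
        A = P *m (\mxdiag_(i < q) ((lam i)%:M + shift_mx (sz i))) *m Q].
Proof.
have [s [s1 sJ sO]] := jordan_blocks A.
pose x (i : 'I_(size s)) := nth (block0 n) s i.
pose P := \mxrow_(i < size s) bcol (x i).
pose Q := \mxcol_(i < size s) brow (x i).
have PQ : P *m Q = 1%:M.
  by rewrite mul_mxrow_mxcol -s1 (big_nth (block0 n)) big_mkord.
exists (size s), (fun i => bval (x i)), (fun i => projT1 (x i)), P, Q; split=> //.
- by move=> i; have [] := sJ i (ltn_ord i).
- rewrite mul_mxcol_mxrow -[RHS]mxdiagZ; apply/eq_mxblockP => i j.
  case: (eqVneq i j) => [<-|nij].
    have [_ -> _] := sJ i (ltn_ord i); rewrite conform_mx_id //.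
  exact: sO.
- rewrite mul_mxrow_mxdiag -[LHS]mulmx1 -PQ mulmxA mul_mxrow; congr (_ *m _).
  by apply: eq_mxrow => i; have [] := sJ i (ltn_ord i).
Qed.
End Jordan.

(** * Finite p-norms *)

Section PNorm.
Context {R : realType} (p : \bar R).
Hypothesis p1 : (1%:E <= p)%E.

(** Meant for families of moduli. An arbitrary finite index type allows norms over pairs and along
    injections; on the moduli of the entries of a vector this is convertible to [vnorm]. *)
Definition pnorm (I : finType) (x : I -> R) : R :=
  match p with
  | r%:E => (\sum_i x i `^ r) `^ r^-1
  | +oo%E => \big[Num.max/0]_i x i
  | -oo%E => 0
  end.

Lemma eq_pnorm (I : finType) (x y : I -> R) : x =1 y -> pnorm x = pnorm y.
Proof. by move=> xy; rewrite (funext xy). Qed.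

Lemma pnorm_ge0 (I : finType) (x : I -> R) : 0 <= pnorm x.
Proof.
by rewrite /pnorm; case: p => [r||] //=; [exact: powR_ge0|exact: bigmax_ge_id].
Qed.

Lemma le_pnorm (I : finType) (x y : I -> R) :
  (forall i, 0 <= x i) -> (forall i, x i <= y i) -> pnorm x <= pnorm y.
Proof.
move=> x0 xy; rewrite /pnorm; case: p p1 => [r||] //= r1; last first.
  exact: le_bigmax2.
rewrite lee_fin in r1; have r0 : 0 <= r by lra.
have ypos i : 0 <= y i := le_trans (x0 i) (xy i).
apply: ge0_ler_powR; rewrite ?invr_ge0 ?nnegrE ?sumr_ge0 //;
  try by move=> *; exact: powR_ge0.
by apply: ler_sum => i _; apply: ge0_ler_powR; rewrite ?nnegrE.
Qed.

Lemma powRVK (a r : R) : 1 <= r -> 0 <= a -> (a `^ r) `^ r^-1 = a.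
Proof. by move=> r1 a0; rewrite -powRrM mulfV ?powRr1 //; lra. Qed.

Lemma powRKV (a r : R) : 1 <= r -> 0 <= a -> (a `^ r^-1) `^ r = a.
Proof. by move=> r1 a0; rewrite -powRrM mulVf ?powRr1 //; lra. Qed.

Lemma pnormZ (I : finType) (c : R) (x : I -> R) : 0 <= c ->
  (forall i, 0 <= x i) -> pnorm (fun i => c * x i) = c * pnorm x.
Proof.
move=> c0 x0; rewrite /pnorm; case: p p1 => [r||] //= r1; last first.
  apply/eqP; rewrite eq_le; apply/andP; split.
    apply: bigmax_le => [|i _]; first by rewrite mulr_ge0 // bigmax_ge_id.
    by rewrite ler_wpM2l // le_bigmax.
  have [->|cn0] := eqVneq c 0; first by rewrite mul0r bigmax_ge_id.
  have cp : 0 < c by rewrite lt_def cn0.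
  rewrite -ler_pdivlMl //; apply: bigmax_le => [|i _].
    by rewrite mulr_ge0 ?invr_ge0 // bigmax_ge_id.
  by rewrite ler_pdivlMl // (le_bigmax _ (fun i => c * x i)).
rewrite lee_fin in r1.
under eq_bigr do rewrite powRM //.
rewrite -mulr_sumr powRM ?powRVK ?powR_ge0 // sumr_ge0 // => i _; exact: powR_ge0.
Qed.

Lemma pnorm_ge (I : finType) (x : I -> R) i : (forall i, 0 <= x i) -> x i <= pnorm x.
Proof.
move=> x0; rewrite /pnorm; case: p p1 => [r||] //= r1; last exact: le_bigmax.
rewrite lee_fin in r1.
rewrite -[leLHS](powRVK r1) //; apply: ge0_ler_powR.
- by rewrite invr_ge0; lra.
- by rewrite nnegrE powR_ge0.
- by rewrite nnegrE sumr_ge0 // => j _; exact: powR_ge0.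
by rewrite (bigD1 i) //= lerDl sumr_ge0 // => j _; exact: powR_ge0.
Qed.

Lemma powR_convex (r a b s t : R) : 1 <= r -> 0 <= a -> 0 <= b -> 0 <= s -> 0 <= t ->
  s + t = 1 -> (s * a + t * b) `^ r <= s * a `^ r + t * b `^ r.
Proof.
move=> r1 a0 b0 s0 t0 st.
have s1 : s <= 1 by lra.
have -> : t = 1 - s by lra.
by apply: (convex_powR r1 (Itv01 s0 s1)) => //=;
  rewrite ?inE /= ?in_itv /= ?a0 ?b0.
Qed.

Lemma pnorm_eq0 (I : finType) (x : I -> R) : (forall i, 0 <= x i) ->
  pnorm x = 0 -> forall i, x i = 0.
Proof.
by move=> x0 px i; apply: le_anti; rewrite x0 andbT -px pnorm_ge.
Qed.

(** Convexity of the unit ball, from which Minkowski's inequality follows by homogeneity. For a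
    finite exponent it is the convexity of the power function, applied entrywise and summed. *)
Lemma pnorm_conv_le1 (I : finType) (x y : I -> R) (s t : R) :
  (forall i, 0 <= x i) -> (forall i, 0 <= y i) -> 0 <= s -> 0 <= t -> s + t = 1 ->
  pnorm x = 1 -> pnorm y = 1 -> pnorm (fun i => s * x i + t * y i) <= 1.
Proof.
move=> x0 y0 s0 t0 st Hx Hy.
have xi i : x i <= 1 by rewrite -Hx pnorm_ge.
have yi i : y i <= 1 by rewrite -Hy pnorm_ge.
have z0 i : 0 <= s * x i + t * y i by rewrite addr_ge0 ?mulr_ge0.
move: Hx Hy; rewrite /pnorm; case: p p1 => [r||] //= r1; last first.
  move=> _ _; apply: bigmax_le => // i _; rewrite -st lerD //.
    by rewrite -[leRHS]mulr1 ler_wpM2l.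
  by rewrite -[leRHS]mulr1 ler_wpM2l.
rewrite lee_fin in r1.
have sum1 (w : I -> R) : (forall i, 0 <= w i) ->
    (\sum_i w i `^ r) `^ r^-1 = 1 -> \sum_i w i `^ r = 1.
  move=> w0 /(congr1 (fun a => a `^ r)).
  by rewrite powRKV ?powR1 // sumr_ge0 // => i _; exact: powR_ge0.
move=> /(sum1 _ x0) Hx /(sum1 _ y0) Hy.
have E1 : 1 `^ r^-1 = 1 :> R by rewrite powR1.
rewrite -[leRHS]E1; apply: ge0_ler_powR.
- by rewrite invr_ge0; lra.
- by rewrite nnegrE sumr_ge0 // => i _; exact: powR_ge0.
- by rewrite nnegrE.
rewrite -st -[s in leRHS]mulr1 -[t in leRHS]mulr1 -{1}Hx -Hy !mulr_sumr -big_split.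
by apply: ler_sum => i _; apply: powR_convex.
Qed.

Lemma pnormD (I : finType) (x y : I -> R) :
  (forall i, 0 <= x i) -> (forall i, 0 <= y i) ->
  pnorm (fun i => x i + y i) <= pnorm x + pnorm y.
Proof.
move=> x0 y0; have [px|px] := eqVneq (pnorm x) 0.
  rewrite px add0r (@eq_pnorm _ _ y) // => i.
  by rewrite (pnorm_eq0 _ px) ?add0r.
have [py|py] := eqVneq (pnorm y) 0.
  rewrite py addr0 (@eq_pnorm _ _ x) // => i.
  by rewrite (pnorm_eq0 _ py) ?addr0.
have [qx qy] : 0 < pnorm x /\ 0 < pnorm y by rewrite !lt_def px py !pnorm_ge0.
set u := pnorm x in px qx *; set v := pnorm y in py qy *.
(* Up to the factor [u + v], the sum is a convex combination of the two normalised families. *)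
have xyE : pnorm (fun i => x i + y i) =
    (u + v) * pnorm (fun i => u / (u + v) * (x i / u) + v / (u + v) * (y i / v)).
  rewrite -pnormZ; [|by lra|]; last first.
    by move=> i; rewrite addr_ge0 // mulr_ge0 ?divr_ge0 //; lra.
  apply: eq_pnorm => i; have : u + v != 0 by lra.
  by move=> uv; field; rewrite uv px py.
rewrite xyE -[leRHS]mulr1 ler_pM2l ?addr_gt0 //.
have Hn (z : I -> R) : (forall i, 0 <= z i) -> 0 < pnorm z ->
    (forall i, 0 <= z i / pnorm z) /\ pnorm (fun i => z i / pnorm z) = 1.
  move=> z0 nz; split=> [i|]; first by rewrite divr_ge0 // ltW.
  rewrite (@eq_pnorm _ _ (fun i => (pnorm z)^-1 * z i)); last by move=> i; rewrite mulrC.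
  by rewrite pnormZ ?invr_ge0 ?pnorm_ge0 // mulVf // gt_eqF.
have {Hn} [] := (Hn x x0 qx, Hn y y0 qy); rewrite -/u -/v.
have : u / (u + v) + v / (u + v) = 1 by rewrite -mulrDl divff // gt_eqF ?addr_gt0.
have : 0 <= v / (u + v) by rewrite divr_ge0 //; lra.
have : 0 <= u / (u + v) by rewrite divr_ge0 //; lra.
by move=> s0 t0 st [X0 HX] [Y0 HY]; apply: (pnorm_conv_le1 X0 Y0).
Qed.

Lemma pnorm_inj (I J : finType) (h : I -> J) (x : J -> R) : injective h ->
  (forall j, 0 <= x j) -> (forall j, j \notin codom h -> x j = 0) ->
  pnorm x = pnorm (x \o h).
Proof.
move=> hI x0 xh; rewrite /pnorm; case: p p1 => [r||] //= r1; last first.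
  apply/eqP; rewrite eq_le; apply/andP; split; apply: bigmax_le;
    rewrite ?bigmax_ge_id // => j _; last exact: le_bigmax.
  have [/codomP[i ->]|/xh ->] := boolP (j \in codom h); last exact: bigmax_ge_id.
  exact: (le_bigmax _ (fun i => x (h i))).
rewrite lee_fin in r1; congr (_ `^ _).
rewrite (bigID (mem (codom h))) /= [X in _ + X]big1 ?addr0 => [|j /xh ->]; last first.
  by rewrite powR0 //; lra.
by rewrite -big_uniq ?map_inj_uniq -?enumT ?enum_uniq //= big_map big_enum.
Qed.

Lemma le_pnorm_inj (I J : finType) (h : I -> J) (x : J -> R) : injective h ->
  (forall j, 0 <= x j) -> pnorm (x \o h) <= pnorm x.
Proof.
move=> hI x0; pose y j := if j \in codom h then x j else 0.
have y0 j : 0 <= y j by rewrite /y; case: ifP.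
rewrite (@eq_pnorm _ _ (y \o h)) => [|i]; last by rewrite /= /y codom_f.
rewrite -(pnorm_inj hI) // => [|j]; first last.
  by rewrite /y => /negPf ->.
by apply: le_pnorm => // j; rewrite /y; case: ifP.
Qed.

(** This is why p-norms suit Kronecker products: a norm over pairs can be computed one coordinate at
    a time, in either order. *)
Lemma pnorm_pair (I J : finType) (z : I * J -> R) : (forall k, 0 <= z k) ->
  pnorm z = pnorm (fun i => pnorm (fun j => z (i, j))).
Proof.
move=> z0; rewrite /pnorm; case: p p1 => [r||] //= r1; last first.
  apply/eqP; rewrite eq_le; apply/andP; split.
    apply: bigmax_le => [|[i j] _]; first exact: bigmax_ge_id.
    apply: (bigmax_sup i) => //.
    exact: (le_bigmax _ (fun j => z (i, j))).
  apply: bigmax_le => [|i _]; first exact: bigmax_ge_id.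
  by apply: bigmax_le => [|j _]; [exact: bigmax_ge_id|exact: le_bigmax].
rewrite lee_fin in r1; congr (_ `^ _).
rewrite [RHS](eq_bigr (fun i => \sum_j z (i, j) `^ r)) => [|i _]; last first.
  by rewrite powRKV // sumr_ge0 // => j _; exact: powR_ge0.
by rewrite pair_bigA /=; apply: eq_bigr => -[].
Qed.

Lemma pnorm_delta (I : finType) (i : I) : pnorm (fun j => (j == i)%:R) = 1.
Proof.
pose h (u : unit) := i.
have hI : injective h by case=> [] [].
rewrite (pnorm_inj hI) //; last first.
  move=> j; apply: contraNeq; rewrite pnatr_eq0 eqb0 negbK => /eqP ->.
  by rewrite (_ : i = h tt) // codom_f.
rewrite /pnorm; case: p p1 => [r||] //= r1.
  rewrite (eq_bigr (fun=> 1)) => [|u _]; last by rewrite /h eqxx powR1.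
  by rewrite sumr_const card_unit powR1.
apply/eqP; rewrite eq_le; apply/andP; split.
  by apply: bigmax_le => // u _; rewrite /h eqxx.
by apply: (bigmax_sup tt) => //; rewrite /h eqxx.
Qed.

Lemma pnorm_sum (I K : finType) (z : K -> I -> R) : (forall k i, 0 <= z k i) ->
  pnorm (fun i => \sum_k z k i) <= \sum_k pnorm (z k).
Proof.
move=> z0.
suff: forall s : seq K, pnorm (fun i => \sum_(k <- s) z k i) <= \sum_(k <- s) pnorm (z k).
  exact.
elim=> [|k s IH].
  rewrite big_nil (@eq_pnorm _ _ (fun i => 0 * 0)) => [|i]; last by rewrite big_nil mul0r.
  by rewrite pnormZ // mul0r.
rewrite big_cons (@eq_pnorm _ _ (fun i => z k i + \sum_(k <- s) z k i)) => [|i];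
  last by rewrite big_cons.
apply: le_trans (pnormD _ _) _ => // [i|]; first by rewrite sumr_ge0.
by rewrite lerD2l.
Qed.

(* The power mean inequality, by averaging the cyclic shifts of z. *)
Lemma pnorm_mean K (z : 'I_K.+1 -> R) : (forall c, 0 <= z c) ->
  pnorm (fun _ : 'I_K.+1 => K.+1%:R^-1 * \sum_c z c) <= pnorm z.
Proof.
move=> z0; rewrite pnormZ ?invr_ge0 //; last by move=> _; rewrite sumr_ge0.
rewrite ler_pdivrMl ?ltr0Sn //.
rewrite (@eq_pnorm _ _ (fun i => \sum_(c < K.+1) z (i + c))) => [|i]; last first.
  by rewrite [LHS](reindex_inj (addrI i)).
apply: le_trans (pnorm_sum _) _ => //.
rewrite (eq_bigr (fun=> pnorm z)) => [|c _]; last first.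
  rewrite [RHS](pnorm_inj (addIr c)) // => j /negP[].
  by apply/codomP; exists (j - c); rewrite /= subrK.
by rewrite sumr_const card_ord [leRHS]mulr_natl.
Qed.
End PNorm.

(** * Induced norms and matrix measures *)

Section Normc.
Context {R : realType}.
Implicit Types x y : R[i].
Local Notation normc := (@Normc.normc R).

Lemma normc_ge0 x : 0 <= normc x.
Proof. by case: x => a b; exact: sqrtr_ge0. Qed.

Lemma normcD x y : normc (x + y) <= normc x + normc y.
Proof. exact: le_normcD. Qed.

Lemma normcR (a : R) : normc (a%:C)%C = `|a|.
Proof. by rewrite /= expr0n addr0 sqrtr_sqr. Qed.

Lemma normc_nat (k : nat) : normc k%:R = k%:R.
Proof. by rewrite -(rmorph_nat (real_complex R)) normcR ger0_norm. Qed.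

Lemma normc_sum (I : Type) (r : seq I) (P : pred I) (F : I -> R[i]) :
  normc (\sum_(i <- r | P i) F i) <= \sum_(i <- r | P i) normc (F i).
Proof.
elim/big_ind2: _ => [|x a y b xa yb|//]; first by rewrite Normc.normc0.
by rewrite (le_trans (normcD _ _)) // lerD.
Qed.
End Normc.

Section MxNorm.
Context {R : realType} (p : \bar R).
Hypothesis p1 : (1%:E <= p)%E.
Local Notation normc := (@Normc.normc R).

Lemma vnorm_ge0 N (v : 'cV[R[i]]_N) : 0 <= vnorm p v.
Proof. exact: pnorm_ge0. Qed.

Lemma vnormZ N c (v : 'cV[R[i]]_N) : vnorm p (c *: v) = normc c * vnorm p v.
Proof.
rewrite -[LHS]/(pnorm p (fun i => normc ((c *: v) i 0))).
rewrite (@eq_pnorm _ p _ _ (fun i => normc c * normc (v i 0))) => [|i].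
  by rewrite (pnormZ p1) // => *; exact: normc_ge0.
by rewrite mxE Normc.normcM.
Qed.

Lemma vnormD N (u v : 'cV[R[i]]_N) : vnorm p (u + v) <= vnorm p u + vnorm p v.
Proof.
apply: le_trans (pnormD p1 _ _); try by move=> i; exact: normc_ge0.
apply: (le_pnorm p1) => i; first exact: normc_ge0.
by rewrite mxE normcD.
Qed.

Lemma vnorm_sum N (I : Type) (r : seq I) (F : I -> 'cV[R[i]]_N) :
  vnorm p (\sum_(i <- r) F i) <= \sum_(i <- r) vnorm p (F i).
Proof.
elim: r => [|i r IH]; first by rewrite !big_nil -(scale0r 0) vnormZ Normc.normc0 mul0r.
by rewrite !big_cons (le_trans (vnormD _ _)) // lerD2l.
Qed.

Lemma vnorm_ge N (v : 'cV[R[i]]_N) i : normc (v i 0) <= vnorm p v.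
Proof. by apply: (pnorm_ge p1 (x := fun i => normc (v i 0))) => j; exact: normc_ge0. Qed.

Lemma vnorm_delta N (i : 'I_N) : vnorm p (delta_mx i 0 : 'cV[R[i]]_N) = 1.
Proof.
rewrite -(pnorm_delta p1 i); apply: eq_pnorm => j.
by rewrite mxE eqxx andbT normc_nat.
Qed.

Lemma vnorm_eq0 N (v : 'cV[R[i]]_N) : vnorm p v = 0 -> v = 0.
Proof.
move=> v0; apply/matrixP => i j; rewrite ord1 mxE; apply: Normc.eq0_normc.
by apply/eqP; rewrite eq_le normc_ge0 andbT -v0 vnorm_ge.
Qed.

(** A crude bound, whose purpose is that the supremum in [mxnorm] ranges over a bounded set. *)
Lemma vnorm_mul_bound N (A : 'M[R[i]]_N) v :
  vnorm p (A *m v) <= (\sum_j vnorm p (col j A)) * vnorm p v.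
Proof.
have -> : A *m v = \sum_j v j 0 *: col j A.
  apply/matrixP => i k; rewrite ord1 mxE summxE; apply: eq_bigr => j _.
  by rewrite !mxE mulrC.
rewrite (le_trans (vnorm_sum _ _)) // mulr_suml; apply: ler_sum => j _.
by rewrite vnormZ mulrC ler_wpM2l ?vnorm_ge0 ?vnorm_ge.
Qed.

Lemma mxnorm_has_ubound N (A : 'M[R[i]]_N) :
  has_ubound [set vnorm p (A *m v) | v in [set v : 'cV[R[i]]_N | vnorm p v = 1]].
Proof.
exists (\sum_j vnorm p (col j A)) => _ [v /= v1 <-].
by rewrite (le_trans (vnorm_mul_bound _ _)) // v1 mulr1.
Qed.

Lemma mxnorm_ge0 N (A : 'M[R[i]]_N) : 0 <= mxnorm p A.
Proof.
rewrite /mxnorm; set S := [set _ | _ in _].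
(* In size 0 no vector has norm 1, and the supremum of the empty set is 0. *)
have [S0|/set0P[_ [v v1 _]]] := eqVneq S set0; first by rewrite S0 sup0.
apply: le_trans (vnorm_ge0 (A *m v)) _; apply: ub_le_sup.
  exact: mxnorm_has_ubound.
by exists v.
Qed.

Lemma vnorm_mul N (A : 'M[R[i]]_N) v : vnorm p (A *m v) <= mxnorm p A * vnorm p v.
Proof.
have [/vnorm_eq0 ->|v0] := eqVneq (vnorm p v) 0.
  rewrite mulmx0 -{1}(scale0r 0) vnormZ Normc.normc0 mul0r.
  by rewrite mulr_ge0 ?mxnorm_ge0 ?vnorm_ge0.
have vp : 0 < vnorm p v by rewrite lt_def v0 vnorm_ge0.
pose c := ((vnorm p v)^-1%:C)%C : R[i].
have nc : normc c = (vnorm p v)^-1 by rewrite normcR ger0_norm // invr_ge0 ltW.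
rewrite -ler_pdivrMr // mulrC -nc -vnormZ scalemxAr.
apply: ub_le_sup; first exact: mxnorm_has_ubound.
by exists (c *: v) => //=; rewrite vnormZ nc mulVf.
Qed.

(** Positivity of [N] provides a unit vector; in size 0 the premise would hold even for a negative
    [c]. *)
Lemma mxnorm_le N (A : 'M[R[i]]_N) c : (0 < N)%N ->
  (forall v, vnorm p (A *m v) <= c * vnorm p v) -> mxnorm p A <= c.
Proof.
case: N A => // N A _ Ac; apply: ge_sup.
  by exists (vnorm p (A *m delta_mx 0 0)), (delta_mx 0 0) => //=; exact: vnorm_delta.
by move=> _ [v /= v1 <-]; rewrite (le_trans (Ac v)) // v1 mulr1.
Qed.

Lemma mxnorm1 N : (0 < N)%N -> mxnorm p (1%:M : 'M[R[i]]_N) = 1.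
Proof.
move=> N0; apply/eqP; rewrite eq_le; apply/andP; split.
  by apply: mxnorm_le => // v; rewrite mul1mx mul1r.
case: N N0 => // N _.
rewrite -(vnorm_delta (ord0 : 'I_N.+1)) -{1}[delta_mx _ _]mul1mx.
by rewrite (le_trans (vnorm_mul _ _)) // vnorm_delta mulr1.
Qed.

Lemma mxnormD N (A B : 'M[R[i]]_N) : (0 < N)%N ->
  mxnorm p (A + B) <= mxnorm p A + mxnorm p B.
Proof.
move=> N0; apply: mxnorm_le => // v; rewrite mulmxDl (le_trans (vnormD _ _)) //.
by rewrite mulrDl lerD ?vnorm_mul.
Qed.

Lemma mxnormZ N c (A : 'M[R[i]]_N) : (0 < N)%N ->
  mxnorm p (c *: A) <= normc c * mxnorm p A.
Proof.
move=> N0; apply: mxnorm_le => // v; rewrite -scalemxAl vnormZ -mulrA.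
by rewrite ler_wpM2l ?normc_ge0 ?vnorm_mul.
Qed.

Lemma mxnormZR N (c : R) (A : 'M[R[i]]_N) : (0 < N)%N -> 0 <= c ->
  mxnorm p ((c%:C)%C *: A) <= c * mxnorm p A.
Proof. by move=> N0 c0; rewrite -{2}(ger0_norm c0) -normcR mxnormZ. Qed.

Lemma mxnormB N (A B : 'M[R[i]]_N) : (0 < N)%N ->
  mxnorm p A <= mxnorm p B + mxnorm p (A - B).
Proof. by move=> N0; rewrite -{1}[A](subrK B) addrC mxnormD. Qed.

Definition mxquot N (A : 'M[R[i]]_N) (e : R) := (mxnorm p (perturb A e) - 1) / e.

(** Convexity of the norm: [perturb A d] is the convex combination of [1] and [perturb A e] with
    weights [1 - d / e] and [d / e]. *)
Lemma mxquot_mono N (A : 'M[R[i]]_N) (d e : R) : (0 < N)%N -> 0 < d -> d <= e ->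
  mxquot A d <= mxquot A e.
Proof.
move=> N0 d0 de; have e0 : 0 < e := lt_le_trans d0 de.
rewrite /mxquot ler_pdivrMr // lerBlDr.
have -> : perturb A d = ((1 - d / e)%:C)%C *: 1%:M + ((d / e)%:C)%C *: perturb A e.
  rewrite /perturb scalerDr addrA -scalerDl scalerA -!rmorphM -!rmorphD /=.
  by rewrite subrK scale1r divfK // gt_eqF.
apply: le_trans (mxnormD _ _ N0) _.
have de1 : d / e <= 1 by rewrite ler_pdivrMr // mul1r.
apply: le_trans (lerD (mxnormZR _ N0 _) (mxnormZR _ N0 _)) _.
- by rewrite subr_ge0.
- by rewrite divr_ge0 // ltW.
rewrite mxnorm1 //; move: (mxnorm _ _) => m.
by rewrite le_eqVlt; apply/orP; left; apply/eqP; field; lra.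
Qed.

Lemma mxquot_ge N (A : 'M[R[i]]_N) (e : R) : (0 < N)%N -> 0 < e ->
  - mxnorm p A <= mxquot A e.
Proof.
move=> N0 e0; rewrite ler_pdivlMr // mulNr.
have := mxnormB (1%:M) (perturb A e) N0.
rewrite mxnorm1 // /perturb opprD addrA subrr add0r.
rewrite -scaleNr -rmorphN /= => H; have := mxnormZ ((- e)%:C)%C A N0.
rewrite normcR normrN gtr0_norm // => H'.
by rewrite lerBrDr addrC lerBlDr (mulrC _ e) (le_trans H) // lerD2l.
Qed.

(** The quotient is monotone in [e] and bounded below by minus the norm of [A], so the [lim] in
    [mxmeasure] is a true limit and not a default value. *)
Lemma mxmeasure_cvg N (A : 'M[R[i]]_N) : (0 < N)%N ->
  mxquot A e @[e --> 0^'+] --> mxmeasure p A.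
Proof.
move=> N0; apply: nondecreasing_at_right_is_cvgr; near=> b.
  move=> x y; rewrite !in_itv /= => /andP[x0 _] _ xy; exact: mxquot_mono.
exists (- mxnorm p A) => y [x /=]; rewrite in_itv /= => /andP[x0 _] <-.
exact: mxquot_ge.
Unshelve. all: by end_near. Qed.

Lemma le_mxmeasure N M (A : 'M[R[i]]_N) (B : 'M[R[i]]_M) : (0 < N)%N -> (0 < M)%N ->
  (forall e, 0 < e -> mxnorm p (perturb A e) <= mxnorm p (perturb B e)) ->
  mxmeasure p A <= mxmeasure p B.
Proof.
move=> N0 M0 AB; apply: ler_cvg_to (mxmeasure_cvg N0) (mxmeasure_cvg M0) _.
near=> e; have e0 : 0 < e by near: e; exact: nbhs_right_gt.
apply: ler_wpM2r; first by rewrite invr_ge0 ltW.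
by rewrite lerD2r AB.
Unshelve. all: by end_near. Qed.

Lemma mxmeasureZ N (c : R) (A : 'M[R[i]]_N) : (0 < N)%N -> 0 < c ->
  mxmeasure p ((c%:C)%C *: A) = c * mxmeasure p A.
Proof.
move=> N0 c0; apply/esym/(cvg_unique _ _ (mxmeasure_cvg N0)) => //.
(* The quotient of [c A] at [e] is [c] times the quotient of [A] at [c e]. *)
have H : c * mxquot A (c * e) @[e --> 0^'+] --> c * mxmeasure p A.
  apply: cvgMl_tmp; apply: cvg_comp (mxmeasure_cvg N0).
  move=> P [d /= d0 HP]; near=> e; have e0 : 0 < e by near: e; exact: nbhs_right_gt.
  apply: HP; last by rewrite /= mulr_gt0.
  rewrite /ball_ /= sub0r normrN gtr0_norm ?mulr_gt0 // mulrC -ltr_pdivlMr //.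
  by near: e; apply: nbhs_right_lt; rewrite divr_gt0.
apply: cvg_trans H; apply: near_eq_cvg; near=> e.
have e0 : 0 < e by near: e; exact: nbhs_right_gt.
rewrite /mxquot /perturb scalerA -rmorphM /= mulrCA (mulrC e); congr (_ * _).
by field; lra.
Unshelve. all: by end_near. Qed.

End MxNorm.

(** Arithmetic for [mxmeasure_kron_sum]: [F] is the norm of the Kronecker product of the two
    perturbations, [L] that of the perturbed Kronecker sum, and [r], [r'] are second-order
    remainders. *)
Lemma quadratic_squeeze (R : realFieldType) (F L r r' e M : R) :
  F <= L + r -> L <= F + r' -> r <= e ^+ 2 * M -> r' <= e ^+ 2 * M ->
  (F - 1 + - M * e * e <= L - 1) && (L - 1 <= F - 1 + M * e * e).
Proof. by rewrite expr2 => *; apply/andP; split; lra. Qed.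

(** * Kronecker products: norms multiply, measures add *)

Section Kron.
Context {R : realType}.
Local Notation C := R[i].

Lemma kron_indexK m n :
  cancel (@kron_index m n) (fun ij => mxvec_index ij.1 ij.2).
Proof.
move=> r.
by rewrite /mxvec_index /kron_index -surjective_pairing enum_valK cast_ordKV.
Qed.

Lemma mxvec_indexK m n :
  cancel (fun ij => mxvec_index ij.1 ij.2) (@kron_index m n).
Proof.
by case=> i j; rewrite /mxvec_index /kron_index cast_ordK enum_rankK.
Qed.

Lemma kron1 m n : kron (1%:M : 'M[C]_m) (1%:M : 'M[C]_n) = 1%:M.
Proof.
apply/matrixP => r c; rewrite !mxE -natrM mulnb.
by rewrite -(inj_eq (can_inj (@kron_indexK m n))) -pair_eqE.
Qed.

Lemma kronDl m1 n1 m2 n2 (A B : 'M[C]_(m1, n1)) (X : 'M[C]_(m2, n2)) :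
  kron (A + B) X = kron A X + kron B X.
Proof. by apply/matrixP => r c; rewrite !mxE mulrDl. Qed.

Lemma kronDr m1 n1 m2 n2 (A B : 'M[C]_(m1, n1)) (X : 'M[C]_(m2, n2)) :
  kron X (A + B) = kron X A + kron X B.
Proof. by apply/matrixP => r c; rewrite !mxE mulrDr. Qed.

Lemma kronZl m1 n1 m2 n2 a (A : 'M[C]_(m1, n1)) (X : 'M[C]_(m2, n2)) :
  kron (a *: A) X = a *: kron A X.
Proof. by apply/matrixP => r c; rewrite !mxE mulrA. Qed.

Lemma kronZr m1 n1 m2 n2 a (A : 'M[C]_(m1, n1)) (X : 'M[C]_(m2, n2)) :
  kron X (a *: A) = a *: kron X A.
Proof. by apply/matrixP => r c; rewrite !mxE mulrCA. Qed.

Section KronNorm.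
Variables (p : \bar R) (m n : nat).
Hypothesis p1 : (1%:E <= p)%E.
Local Notation normc := (@Normc.normc R).

Lemma vnorm_pair (v : 'cV[C]_(m * n)) :
  vnorm p v = pnorm p (fun ij => normc (v (mxvec_index ij.1 ij.2) 0)).
Proof.
pose h (ij : 'I_m * 'I_n) := mxvec_index ij.1 ij.2.
have hI : injective h by exact: can_inj (@mxvec_indexK m n).
rewrite -[LHS]/(pnorm p (fun r => normc (v r 0))) (pnorm_inj p1 hI) //.
  by move=> r; exact: normc_ge0.
move=> r /negP[].
by apply/codomP; exists (kron_index r); rewrite /h kron_indexK.
Qed.

Lemma kron_mulE (X : 'M[C]_m) (Y : 'M[C]_n) v i j :
  (kron X Y *m v : 'cV_(m * n)) (mxvec_index i j) 0 =
  \sum_k X i k * \sum_l Y j l * v (mxvec_index k l) 0.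
Proof.
pose h (ij : 'I_m * 'I_n) := mxvec_index ij.1 ij.2.
rewrite mxE (reindex h) /=; last first.
  by apply: onW_bij; exists (@kron_index m n); [exact: mxvec_indexK|exact: kron_indexK].
under [RHS]eq_bigr do rewrite mulr_sumr.
rewrite pair_bigA /=; apply: eq_bigr => -[k l] _ /=.
by rewrite mxE -[mxvec_index i j]/(h (i, j)) /h !mxvec_indexK mulrA.
Qed.

(** For the upper bound, [Y] acts along one coordinate and [X] along the other, and the order of the
    iterated norm is exchanged in between. For the lower bound, elementary tensors are used as test
    vectors. *)
Lemma mxnorm_kron (X : 'M[C]_m) (Y : 'M[C]_n) : (0 < m)%N -> (0 < n)%N ->
  mxnorm p (kron X Y) = mxnorm p X * mxnorm p Y.
Proof.
move=> m0 n0; have mn0 : (0 < m * n)%N by rewrite muln_gt0 m0.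
apply/eqP; rewrite eq_le; apply/andP; split.
  apply: (mxnorm_le p1 mn0) => v.
  (* With [v] read as an [m] by [n] array, the [W i] are its rows and the [Z j] are the columns of
     the array after [Y] has acted on each row. *)
  pose W i : 'cV[C]_n := \col_l v (mxvec_index i l) 0.
  pose Z j : 'cV[C]_m := \col_k (Y *m W k) j 0.
  have E i j : (kron X Y *m v) (mxvec_index i j) 0 = (X *m Z j) i 0.
    rewrite kron_mulE [RHS]mxE; apply: eq_bigr => k _; rewrite !mxE; congr (_ * _).
    by apply: eq_bigr => l _; rewrite !mxE.
  have swapI : injective (fun ij : 'I_m * 'I_n => (ij.2, ij.1)) by move=> [? ?] [? ?] [-> ->].
  have step1 : vnorm p (kron X Y *m v) = pnorm p (fun j => vnorm p (X *m Z j)).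
    rewrite vnorm_pair.
    pose z (ji : 'I_n * 'I_m) := normc ((X *m Z ji.1) ji.2 0).
    rewrite (@eq_pnorm _ _ _ _ (z \o (fun ij : 'I_m * 'I_n => (ij.2, ij.1)))) => [|[i j]]; last first.
      by rewrite /z /= E.
    rewrite -(pnorm_inj p1 swapI) ?(pnorm_pair p1) // => [ji|ji|[j i] /negP[]]; try exact: normc_ge0.
    by apply/codomP; exists (i, j).
  have step2 : pnorm p (fun j => vnorm p (Z j)) = pnorm p (fun i => vnorm p (Y *m W i)).
    pose z (ij : 'I_m * 'I_n) := normc ((Y *m W ij.1) ij.2 0).
    transitivity (pnorm p z); last first.
      by rewrite (pnorm_pair p1) // => ij; exact: normc_ge0.
    have swapI' : injective (fun ij : 'I_n * 'I_m => (ij.2, ij.1)) by move=> [? ?] [? ?] [-> ->].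
    rewrite (pnorm_inj p1 swapI') => [|ij|[i j] /negP[]]; first last.
    - by apply/codomP; exists (j, i).
    - exact: normc_ge0.
    rewrite (pnorm_pair p1) => [|ij]; last exact: normc_ge0.
    apply: eq_pnorm => j; apply: eq_pnorm => k; by rewrite /z mxE.
  have step3 : vnorm p v = pnorm p (fun i => vnorm p (W i)).
    rewrite vnorm_pair (pnorm_pair p1) => [|ij]; last exact: normc_ge0.
    by apply: eq_pnorm => i; apply: eq_pnorm => j; rewrite mxE.
  rewrite step1 step3 -mulrA.
  apply: (@le_trans _ _ (mxnorm p X * pnorm p (fun j => vnorm p (Z j)))).
    rewrite -(pnormZ p1) ?mxnorm_ge0 // => [|i]; last exact: vnorm_ge0.
    by apply: (le_pnorm p1) => i; [exact: vnorm_ge0|exact: vnorm_mul].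
  rewrite ler_wpM2l ?mxnorm_ge0 // step2 -(pnormZ p1) ?mxnorm_ge0 // => [|i]; last exact: vnorm_ge0.
  by apply: (le_pnorm p1) => i; [exact: vnorm_ge0|exact: vnorm_mul].
(* The bound on elementary tensors. The suprema over [u] and then over [w] are taken one after the
   other, each time dividing by the other factor once it is known to be nonzero. *)
have key (u : 'cV_m) (w : 'cV_n) :
    vnorm p (X *m u) * vnorm p (Y *m w) <= mxnorm p (kron X Y) * (vnorm p u * vnorm p w).
  pose tens (a : 'cV[C]_m) (b : 'cV[C]_n) : 'cV[C]_(m * n) :=
    \col_r (a (kron_index r).1 0 * b (kron_index r).2 0).
  have tE a b i j : tens a b (mxvec_index i j) 0 = a i 0 * b j 0.
    by rewrite mxE (mxvec_indexK (i, j)).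
  have tn a b : vnorm p (tens a b) = vnorm p a * vnorm p b.
    rewrite vnorm_pair (pnorm_pair p1) => [|ij]; last exact: normc_ge0.
    rewrite mulrC -(pnormZ p1) ?vnorm_ge0 // => [|i]; last exact: normc_ge0.
    apply: eq_pnorm => i; rewrite mulrC -(pnormZ p1) ?normc_ge0 // => [|j]; last exact: normc_ge0.
    by apply: eq_pnorm => j; rewrite tE Normc.normcM.
  have -> : vnorm p (X *m u) * vnorm p (Y *m w) = vnorm p (kron X Y *m tens u w).
    rewrite -tn; congr (vnorm p _); apply/matrixP => r c; rewrite ord1 => {c}.
    have -> : r = mxvec_index (kron_index r).1 (kron_index r).2 by rewrite kron_indexK.
    rewrite tE kron_mulE mxE mulr_suml; apply: eq_bigr => k _.
    rewrite mxE -mulrA mulr_sumr; congr (_ * _); apply: eq_bigr => l _.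
    by rewrite tE mulrCA.
  by rewrite -tn vnorm_mul.
have [Y0|Y0] := eqVneq (mxnorm p Y) 0; first by rewrite Y0 mulr0 mxnorm_ge0.
have Yp : 0 < mxnorm p Y by rewrite lt_def Y0 mxnorm_ge0.
rewrite -ler_pdivlMr //; apply: (mxnorm_le p1 m0) => u.
rewrite mulrAC ler_pdivlMr //.
have [Xu|Xu] := eqVneq (vnorm p (X *m u)) 0.
  by rewrite Xu mul0r mulr_ge0 ?mxnorm_ge0 ?vnorm_ge0.
have Xp : 0 < vnorm p (X *m u) by rewrite lt_def Xu vnorm_ge0.
rewrite mulrC -ler_pdivlMr //; apply: (mxnorm_le p1 n0) => w.
by rewrite mulrAC ler_pdivlMr // mulrC -mulrA key.
Qed.

(** The product [(1 + e A) (x) (1 + e B)] differs from [1 + e K] by [e^2 A (x) B] only. Its norm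
    factors, so its quotient is [q_A + q_B + e q_A q_B], and the remainder changes this by at most
    [M e]. *)
Lemma mxmeasure_kron_sum (A : 'M[C]_m) (B : 'M[C]_n) : (0 < m)%N -> (0 < n)%N ->
  mxmeasure p (kron A 1%:M + kron 1%:M B) = mxmeasure p A + mxmeasure p B.
Proof.
move=> m0 n0; have mn0 : (0 < m * n)%N by rewrite muln_gt0 m0.
set K := _ + _; pose M := mxnorm p (kron A B).
have fact e : kron (perturb A e) (perturb B e) =
    perturb K e + ((e ^+ 2)%:C)%C *: kron A B.
  rewrite /perturb kronDl !kronDr !kronZl !kronZr kron1 scalerA scalerDr -!addrA.
  by rewrite expr2 rmorphM; congr (_ + _); exact: addrCA.
have cvgK := @mxmeasure_cvg _ _ p1 _ K mn0.
have cvgA := @mxmeasure_cvg _ _ p1 _ A m0.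
have cvgB := @mxmeasure_cvg _ _ p1 _ B n0.
have cvgid : e @[e --> (0 : R)^'+] --> (0 : R).
  by apply: cvg_within_filter; exact: cvg_id.
pose h e := mxquot p A e + mxquot p B e + e * (mxquot p A e * mxquot p B e).
have cvgh c : h e + c * e @[e --> 0^'+] --> mxmeasure p A + mxmeasure p B.
  have -> : mxmeasure p A + mxmeasure p B = mxmeasure p A + mxmeasure p B +
    0 * (mxmeasure p A * mxmeasure p B) + c * 0 by rewrite mul0r mulr0 !addr0.
  apply: cvgD; last exact: cvgMl_tmp.
  by apply: cvgD; [exact: cvgD|apply: cvgM => //; exact: cvgM].
have cvgh1 := cvgh (- M); have cvgh2 := cvgh M.
apply: (cvg_unique _ cvgK) => //.
apply: squeeze_cvgr cvgh1 cvgh2; near=> e.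
have e0 : 0 < e by near: e; exact: nbhs_right_gt.
have hE : h e = (mxnorm p (perturb A e) * mxnorm p (perturb B e) - 1) / e.
  by rewrite /h /mxquot; field; lra.
rewrite hE -mxnorm_kron // /mxquot fact.
have e2 : `|e ^+ 2| = e ^+ 2 by rewrite ger0_norm // exprn_ge0 // ltW.
have le1 := mxnormD p1 (perturb K e) (((e ^+ 2)%:C)%C *: kron A B) mn0.
have le2 := mxnormB p1 (perturb K e) (perturb K e + ((e ^+ 2)%:C)%C *: kron A B) mn0.
rewrite opprD addrA subrr add0r -scaleNr in le2.
have := mxnormZ p1 (- ((e ^+ 2)%:C)%C) (kron A B) mn0.
have := mxnormZ p1 ((e ^+ 2)%:C)%C (kron A B) mn0.
rewrite normcN !normcR e2 -/M => leM leM'.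
rewrite ler_pdivlMr // mulrDl divfK ?gt_eqF // ler_pdivrMr // mulrDl divfK ?gt_eqF //.
exact: (quadratic_squeeze le1 le2 leM leM').
Unshelve. all: by end_near. Qed.

End KronNorm.
End Kron.

(** * Principal powers near the identity *)

Section CDeriv.
Context {R : realType}.
Local Notation C := R[i].
Local Notation normc := (@Normc.normc R).
Implicit Types (f g : R -> C) (t : R).

Definition cderiv f t (l : C) : Prop :=
  is_derive t 1 (fun u => complex.Re (f u)) (complex.Re l) /\
  is_derive t 1 (fun u => complex.Im (f u)) (complex.Im l).

Lemma cderiv_eq f t l l' : cderiv f t l -> l = l' -> cderiv f t l'.
Proof. by move=> H <-. Qed.

Lemma cderiv_cst (c : C) t : cderiv (fun=> c) t 0.
Proof. by split; exact: is_derive_cst. Qed.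

Lemma cderivD f g t l m : cderiv f t l -> cderiv g t m ->
  cderiv (fun u => f u + g u) t (l + m).
Proof.
move=> [f1 f2] [g1 g2]; split.
  have := is_deriveD f1 g1; rewrite -raddfD.
  by congr (is_derive _ _ _ _); apply/funext => u; rewrite !fctE; case: (f u) (g u) => ? ? [].
have := is_deriveD f2 g2; rewrite -raddfD.
by congr (is_derive _ _ _ _); apply/funext => u; rewrite !fctE; case: (f u) (g u) => ? ? [].
Qed.

Lemma cderivM f g t l m : cderiv f t l -> cderiv g t m ->
  cderiv (fun u => f u * g u) t (l * g t + f t * m).
Proof.
move=> [f1 f2] [g1 g2]; split.
  have := is_deriveB (is_deriveM f1 g1) (is_deriveM f2 g2).
  rewrite (_ : _ - _ = (fun u => complex.Re (f u * g u))); last first.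
    by apply/funext => u; rewrite !fctE; case: (f u) (g u) => ? ? [].
  move/is_derive_eq; apply; rewrite /GRing.scale /=.
  by case: l m (f t) (g t) {f1 f2 g1 g2} => a b [c d] [a' b'] [c' d'] /=; ring.
have := is_deriveD (is_deriveM f1 g2) (is_deriveM f2 g1).
rewrite (_ : _ + _ = (fun u => complex.Im (f u * g u))); last first.
  by apply/funext => u; rewrite !fctE; case: (f u) (g u) => ? ? [].
move/is_derive_eq; apply; rewrite /GRing.scale /=.
by case: l m (f t) (g t) {f1 f2 g1 g2} => a b [c d] [a' b'] [c' d'] /=; ring.
Qed.

Lemma cderiv_sum (I : Type) (r : seq I) (f : I -> R -> C) t l :
  (forall i, cderiv (f i) t (l i)) ->
  cderiv (fun u => \sum_(i <- r) f i u) t (\sum_(i <- r) l i).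
Proof.
move=> fl; elim: r => [|i r IH].
  rewrite big_nil; under [X in cderiv X]eq_fun do rewrite big_nil.
  exact: cderiv_cst.
rewrite big_cons; under [X in cderiv X]eq_fun do rewrite big_cons.
exact: cderivD.
Qed.

Lemma cderivZ (c : C) f t l : cderiv f t l -> cderiv (fun u => c * f u) t (c * l).
Proof.
move=> fl; apply: cderiv_eq (cderivM (cderiv_cst c t) fl) _.
by rewrite mul0r add0r.
Qed.

Lemma cderiv_id t : cderiv (fun u => (u%:C)%C) t 1.
Proof. by split => /=; [exact: is_derive_id|exact: is_derive_cst]. Qed.

Lemma cderivXn f t l n : cderiv f t l ->
  cderiv (fun u => f u ^+ n) t (n%:R * f t ^+ n.-1 * l).
Proof.
move=> fl; elim: n => [|n IH].
  by rewrite mul0r mul0r; exact: cderiv_cst.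
under [X in cderiv X]eq_fun do rewrite exprS.
apply: cderiv_eq (cderivM fl IH) _.
case: n {IH} => [|n] /=; first by rewrite !expr0; ring.
by rewrite exprS -[n.+2]addn1 natrD; ring.
Qed.

(* The principal power on the half-plane Re > 0, where it is smooth. *)
Definition hpow (u : C) (b : R) : C :=
  (((Num.sqrt (complex.Re u ^+ 2 + complex.Im u ^+ 2)) `^ b)%:C *
   (cos (b * atan (complex.Im u / complex.Re u)) +i*
    sin (b * atan (complex.Im u / complex.Re u))))%C.

Lemma normc_sqrt (u : C) :
  normc u = Num.sqrt (complex.Re u ^+ 2 + complex.Im u ^+ 2).
Proof. by case: u. Qed.

Lemma cos_atan_div (x y : R) : 0 < x -> cos (atan (y / x)) = x / Num.sqrt (x ^+ 2 + y ^+ 2).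
Proof.
move=> x0; rewrite cos_atan.
have -> : x ^+ 2 + y ^+ 2 = x ^+ 2 * (1 + (y / x) ^+ 2) by field; lra.
rewrite sqrtrM ?exprn_ge0 ?ltW // sqrtr_sqr gtr0_norm //.
by rewrite invfM mulrA divff ?mul1r // gt_eqF.
Qed.

Lemma sin_atan_div (x y : R) : 0 < x -> sin (atan (y / x)) = y / Num.sqrt (x ^+ 2 + y ^+ 2).
Proof.
move=> x0.
have cn0 : cos (atan (y / x)) != 0 by rewrite gt_eqF // cos_atan invr_gt0 sqrtr_gt0; nra.
have := atanK (y / x); rewrite /tan => /(congr1 ( *%R^~ (cos (atan (y / x))))).
rewrite divfK // => ->; rewrite cos_atan_div //.
by rewrite mulrA divfK // gt_eqF.
Qed.

(** On the right half-plane both branches of [carg] reduce to [atan (y / x)], which lies in ]-pi/2,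
    pi/2[ and has the sign of [y]. *)
Lemma cpowE (u : C) b : 0 < complex.Re u -> cpow u b = hpow u b.
Proof.
move=> u0; rewrite /cpow /hpow -normc_sqrt.
suff -> : carg u = atan (complex.Im u / complex.Re u) by [].
rewrite /carg normc_sqrt -cos_atan_div //; case: ifPn => [y0|].
  rewrite cosK // in_itv /=; apply/andP; split.
    by rewrite -atan0 le_atan // divr_ge0 // ltW.
  have := atan_ltpi2 (complex.Im u / complex.Re u); have := pi_gt0 R; lra.
rewrite -ltNge => y0; rewrite cosKN ?opprK //; apply/andP; split; last first.
  by rewrite -atan0 le_atan // ltW // pmulr_llt0 // invr_gt0.
have := atan_gtNpi2 (complex.Im u / complex.Re u); have := pi_gt0 R; lra.
Qed.

Lemma hpowD (u : C) b c : 0 < complex.Re u -> hpow u (b + c) = hpow u b * hpow u c.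
Proof.
move=> u0; rewrite /hpow powRD; last first.
  by apply/implyP => _; rewrite gt_eqF // sqrtr_gt0; nra.
rewrite mulrDl cosD sinD rmorphM mulrACA; congr (_ * _).
by apply/eqP; rewrite eq_complex /=; apply/andP; split; apply/eqP; ring.
Qed.

Lemma hpow1 (u : C) : 0 < complex.Re u -> hpow u 1 = u.
Proof.
case: u => x y /= x0; rewrite /hpow /= !mul1r powRr1 ?sqrtr_ge0 //.
rewrite cos_atan_div // sin_atan_div //.
have s0 : 0 < Num.sqrt (x ^+ 2 + y ^+ 2) by rewrite sqrtr_gt0; nra.
by simpc; congr (_ +i* _)%C; rewrite mulrC divfK // gt_eqF.
Qed.

Lemma hpow_one b : hpow 1 b = 1.
Proof.
rewrite /hpow /= expr0n expr1n addr0 sqrtr1 powR1 mul0r atan0 mulr0 cos0 sin0.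
by rewrite mul1r.
Qed.

Lemma is_derive_conv (F G : R -> R) (t l m : R) :
  is_derive t 1 F l -> F = G -> l = m -> is_derive t 1 G m.
Proof. by move=> H <- <-. Qed.

(** The chain rule for the complex power, checked in polar form: the modulus [N] and the angle [th]
    are differentiated as real functions, and the addition formulas for the angle [(b - 1) th] match
    the result. *)
Lemma cderiv_hpow (w : C) b t : 0 < complex.Re (1 + (t%:C)%C * w) ->
  cderiv (fun s => hpow (1 + (s%:C)%C * w) b) t
    ((b%:C)%C * w * hpow (1 + (t%:C)%C * w) (b - 1)).
Proof.
case: w => w1 w2 /=; rewrite mul0r subr0 => x0.
pose x (s : R) := 1 + s * w1; pose y (s : R) := s * w2.
pose N s := Num.sqrt (x s ^+ 2 + y s ^+ 2).
pose th s := atan (y s / x s).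
have N0 : 0 < N t by rewrite sqrtr_gt0 /x; nra.
have dx : is_derive t 1 x w1.
  apply: is_derive_conv (is_deriveD (is_derive_cst (1 : R) t 1)
    (is_deriveM (is_derive_id t 1) (is_derive_cst w1 t 1))) _ _.
    by apply/funext => s.
  by rewrite /GRing.scale /=; ring.
have dy : is_derive t 1 y w2.
  apply: is_derive_conv (is_deriveM (is_derive_id t 1) (is_derive_cst w2 t 1)) _ _.
    by apply/funext => s.
  by rewrite /GRing.scale /=; ring.
have xt0 : 0 < x t by [].
have N2 : N t ^+ 2 = x t ^+ 2 + y t ^+ 2 by rewrite sqr_sqrtr //; nra.
have dN : is_derive t 1 N ((x t * w1 + y t * w2) / N t).
  have d2 : is_derive t 1 (fun s => x s ^+ 2 + y s ^+ 2) (2 * (x t * w1 + y t * w2)).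
    apply: is_derive_conv (is_deriveD (is_deriveM dx dx) (is_deriveM dy dy)) _ _.
      by apply/funext => s; rewrite !fctE !expr2.
    by rewrite /GRing.scale /=; ring.
  have p0 : 0 < x t ^+ 2 + y t ^+ 2 by nra.
  apply: is_derive_conv (@is_derive1_comp _ _ (fun s => x s ^+ 2 + y s ^+ 2) _ _ _
    (is_derive1_sqrt p0) d2) _ _ => //.
  by rewrite -/(N t); field; rewrite gt_eqF.
have dth : is_derive t 1 th ((w2 * x t - y t * w1) / N t ^+ 2).
  have d2 : is_derive t 1 (fun s => y s / x s) ((w2 * x t - y t * w1) / x t ^+ 2).
    apply: is_derive_conv (is_deriveM dy (is_deriveV _ dx)) _ _; rewrite ?gt_eqF //.
    by rewrite /GRing.scale /=; field; rewrite gt_eqF.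
  apply: is_derive_conv (@is_derive1_comp _ _ (fun s => y s / x s) _ _ _
    (is_derive1_atan (y t / x t)) d2) _ _ => //.
  by rewrite N2; field; rewrite !gt_eqF //; nra.
have dP : is_derive t 1 (fun s => N s `^ b)
    (b * N t `^ (b - 1) * ((x t * w1 + y t * w2) / N t)).
  by apply: is_derive_conv (@is_derive1_comp _ _ N _ _ _ (is_derive1_powR b N0) dN) _ _.
have dbth : is_derive t 1 (fun s => b * th s) (b * ((w2 * x t - y t * w1) / N t ^+ 2)).
  apply: is_derive_conv (is_deriveM (is_derive_cst b t 1) dth) _ _; first by apply/funext.
  by rewrite /GRing.scale /=; ring.
have dc := @is_derive1_comp _ _ (fun s => b * th s) _ _ _ (is_derive_cos (b * th t)) dbth.
have ds := @is_derive1_comp _ _ (fun s => b * th s) _ _ _ (is_derive_sin (b * th t)) dbth.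
have NbE : N t `^ b = N t `^ (b - 1) * N t.
  rewrite -[in X in _ * X](powRr1 (ltW N0)) -powRD ?subrK //.
  by apply/implyP => _; rewrite gt_eqF.
have hE c s : hpow (1 + (s%:C)%C * (w1 +i* w2)%C) c =
    (N s `^ c * cos (c * th s) +i* (N s `^ c * sin (c * th s)))%C.
  have -> : 1 + (s%:C)%C * (w1 +i* w2)%C = (x s +i* y s)%C.
    by apply/eqP; rewrite eq_complex /=; apply/andP; split; apply/eqP; rewrite /x /y; ring.
  by rewrite /hpow -/(N s) -/(th s); simpc.
have cth : cos ((b - 1) * th t) = cos (b * th t) * (x t / N t) + sin (b * th t) * (y t / N t).
  by rewrite mulrBl mul1r cosB cos_atan_div // sin_atan_div.
have sth : sin ((b - 1) * th t) = sin (b * th t) * (x t / N t) - cos (b * th t) * (y t / N t).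
  by rewrite mulrBl mul1r sinB cos_atan_div // sin_atan_div.
rewrite hE cth sth; split.
  apply: is_derive_conv (is_deriveM dP dc) _ _.
    by apply/funext => s; rewrite hE.
  by rewrite /GRing.scale /= NbE; field; rewrite gt_eqF.
apply: is_derive_conv (is_deriveM dP ds) _ _.
  by apply/funext => s; rewrite hE.
by rewrite /GRing.scale /= NbE; field; rewrite gt_eqF.
Qed.

End CDeriv.

(** * Entrywise calculus and mean value bounds for paths of matrices *)

Section SumNorm.
Context {R : realType}.
Local Notation C := R[i].
Local Notation normc := (@Normc.normc R).

Definition sumnorm m n (A : 'M[C]_(m, n)) : R := \sum_i \sum_j normc (A i j).

Lemma sumnorm_ge0 m n (A : 'M[C]_(m, n)) : 0 <= sumnorm A.
Proof. by rewrite !sumr_ge0 // => i _; rewrite sumr_ge0 // => j _; exact: normc_ge0. Qed.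

Lemma sumnorm_ge m n (A : 'M[C]_(m, n)) i j : normc (A i j) <= sumnorm A.
Proof.
rewrite /sumnorm (bigD1 i) //= (bigD1 j) //= -addrA lerDl addr_ge0 //.
  by rewrite sumr_ge0 // => k _; exact: normc_ge0.
by rewrite sumr_ge0 // => k _; rewrite sumr_ge0 // => l _; exact: normc_ge0.
Qed.

Lemma sumnormD m n (A B : 'M[C]_(m, n)) : sumnorm (A + B) <= sumnorm A + sumnorm B.
Proof.
rewrite /sumnorm -big_split; apply: ler_sum => i _; rewrite -big_split.
by apply: ler_sum => j _; rewrite mxE normcD.
Qed.

Lemma sumnormZ m n c (A : 'M[C]_(m, n)) : sumnorm (c *: A) = normc c * sumnorm A.
Proof.
rewrite /sumnorm mulr_sumr; apply: eq_bigr => i _; rewrite mulr_sumr.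
by apply: eq_bigr => j _; rewrite mxE Normc.normcM.
Qed.

Lemma sumnormB m n (A B : 'M[C]_(m, n)) : sumnorm (A - B) <= sumnorm A + sumnorm B.
Proof.
apply: le_trans (sumnormD _ _) _; rewrite -scaleN1r sumnormZ normcN.
by rewrite Normc.normc1 mul1r.
Qed.

Lemma sumnormM m n k (A : 'M[C]_(m, n)) (B : 'M[C]_(n, k)) :
  sumnorm (A *m B) <= sumnorm A * sumnorm B.
Proof.
rewrite /sumnorm mulr_suml; apply: ler_sum => i _.
apply: (@le_trans _ _ (\sum_j \sum_l normc (A i l) * normc (B l j))).
  apply: ler_sum => j _; rewrite mxE (le_trans (normc_sum _ _ _)) //.
  by apply: ler_sum => l _; rewrite Normc.normcM.
rewrite exchange_big mulr_suml; apply: ler_sum => l _.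
rewrite -mulr_sumr ler_wpM2l ?normc_ge0 // (bigD1 l) //= lerDl.
by rewrite sumr_ge0 // => p _; rewrite sumr_ge0 // => q _; exact: normc_ge0.
Qed.

Lemma normRe_le (z : C) : `|complex.Re z| <= normc z.
Proof.
by case: z => x y /=; rewrite -[leLHS]sqrtr_sqr; apply: ler_wsqrtr; rewrite lerDl sqr_ge0.
Qed.

Lemma normIm_le (z : C) : `|complex.Im z| <= normc z.
Proof.
by case: z => x y /=; rewrite -[leLHS]sqrtr_sqr; apply: ler_wsqrtr; rewrite lerDr sqr_ge0.
Qed.

Lemma normc_le_ReIm (z : C) : normc z <= `|complex.Re z| + `|complex.Im z|.
Proof.
case: z => x y /=; rewrite -[leRHS]ger0_norm ?addr_ge0 // -[leRHS]sqrtr_sqr; apply: ler_wsqrtr.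
rewrite -(real_normK (num_real x)) -(real_normK (num_real y)) sqrrD lerD2r lerDl.
by rewrite mulrn_wge0 // mulr_ge0.
Qed.

(** The mean value theorem is applied to the real and imaginary parts separately, since it has no
    complex-valued form; hence the factor 2. *)
Lemma cderiv_mvt (f df : R -> C) (B : R) :
  (forall t : R, 0 <= t <= 1 -> cderiv f t (df t)) ->
  (forall t : R, 0 <= t <= 1 -> normc (df t) <= B) ->
  forall t : R, 0 <= t <= 1 -> normc (f t - f 0) <= 2 * B.
Proof.
move=> fd dfB t /andP[t0 t1].
have B0 : 0 <= B by apply: le_trans (normc_ge0 _) (dfB 0 _); rewrite lexx ler01.
have real_mvt (g dg : R -> R) : (forall s : R, 0 <= s <= 1 -> is_derive s 1 g (dg s)) ->
    (forall s : R, 0 <= s <= 1 -> `|dg s| <= B) -> `|g t - g 0| <= B.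
  move=> gd gB; have gd' s : s \in `]0, t[ -> is_derive s 1 g (dg s).
    by rewrite in_itv /= => /andP[s0 st]; apply: gd; rewrite ltW //= ltW // (lt_le_trans st).
  have cg : {within `[0, t], continuous g}.
    apply: derivable_within_continuous => s; rewrite in_itv /= => /andP[s0 st].
    by have [] := gd s _; rewrite // s0 (le_trans st).
  have [s] := MVT_segment t0 gd' cg; rewrite in_itv /= => /andP[s0 st] ->.
  rewrite subr0 normrM (ger0_norm t0) -[leRHS]mulr1.
  by rewrite ler_pM // gB // s0 (le_trans st).
apply: le_trans (normc_le_ReIm _) _; rewrite mulr_natl mulr2n !raddfB; apply: lerD.
  apply: (real_mvt (fun s => complex.Re (f s)) (fun s => complex.Re (df s))) => s s01.
  by have [] := fd s s01.
  by rewrite (le_trans (normRe_le _)) ?dfB.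
apply: (real_mvt (fun s => complex.Im (f s)) (fun s => complex.Im (df s))) => s s01.
  by have [] := fd s s01.
by rewrite (le_trans (normIm_le _)) ?dfB.
Qed.

Lemma cderiv_bounded (f df : R -> C) :
  (forall t : R, 0 <= t <= 1 -> cderiv f t (df t)) ->
  exists B : R, forall t : R, 0 <= t <= 1 -> normc (f t) <= B.
Proof.
move=> fd.
have real_bd (g dg : R -> R) : (forall s : R, 0 <= s <= 1 -> is_derive s 1 g (dg s)) ->
    exists B : R, forall t : R, 0 <= t <= 1 -> `|g t| <= B.
  move=> gd; have cg : {within `[0, 1], continuous g}.
    apply: derivable_within_continuous => s; rewrite in_itv /= => s01.
    by have [] := gd s s01.
  have [c _ cM] := EVT_max ler01 cg; have [d _ dm] := EVT_min ler01 cg.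
  exists (`|g c| + `|g d|) => t t01.
  have := cM t; have := dm t; rewrite !in_itv /= => /(_ t01) h1 /(_ t01) h2.
  rewrite ler_norml; apply/andP; split.
    by have := normr_ge0 (g c); have := ler_norm (- g d); rewrite normrN; lra.
  by have := ler_norm (g c); have := normr_ge0 (g d); lra.
have [B1 H1] := real_bd _ _ (fun s s01 => (fd s s01).1).
have [B2 H2] := real_bd _ _ (fun s s01 => (fd s s01).2).
exists (B1 + B2) => t t01; apply: le_trans (normc_le_ReIm _) _.
by rewrite lerD ?H1 ?H2.
Qed.

Definition mderiv m n (Y : R -> 'M[C]_(m, n)) t (Z : 'M[C]_(m, n)) : Prop :=
  forall i j, cderiv (fun u => Y u i j) t (Z i j).

Lemma mderiv_mvt m n (Y Z : R -> 'M[C]_(m, n)) (B : R) :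
  (forall t : R, 0 <= t <= 1 -> mderiv Y t (Z t)) ->
  (forall t : R, 0 <= t <= 1 -> sumnorm (Z t) <= B) ->
  forall t : R, 0 <= t <= 1 -> sumnorm (Y t - Y 0) <= 2 * (m * n)%:R * B.
Proof.
move=> YZ ZB t t01; apply: (@le_trans _ _ (\sum_(i < m) \sum_(j < n) 2 * B)).
  apply: ler_sum => i _; apply: ler_sum => j _; rewrite !mxE.
  apply: (cderiv_mvt (f := fun s => Y s i j) (df := fun s => Z s i j)) => // s s01; first exact: YZ.
  by rewrite (le_trans (sumnorm_ge _ _ _)) ?ZB.
rewrite !sumr_const !card_ord -mulrnA -[leLHS]mulr_natr !natrM.
by rewrite le_eqVlt; apply/orP; left; apply/eqP; ring.
Qed.

Lemma mderiv_bounded m n (Y Z : R -> 'M[C]_(m, n)) :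
  (forall t : R, 0 <= t <= 1 -> mderiv Y t (Z t)) ->
  exists B : R, forall t : R, 0 <= t <= 1 -> sumnorm (Y t) <= B.
Proof.
move=> YZ.
have H i j : {B : R | forall t : R, 0 <= t <= 1 -> normc (Y t i j) <= B}.
  apply: cid; apply: (cderiv_bounded (f := fun s => Y s i j) (df := fun s => Z s i j)) => t t01; exact: YZ.
exists (\sum_i \sum_j sval (H i j)) => t t01.
by apply: ler_sum => i _; apply: ler_sum => j _; exact: (svalP (H i j)).
Qed.

Lemma mderivD m n (Y Z : R -> 'M[C]_(m, n)) t Y' Z' :
  mderiv Y t Y' -> mderiv Z t Z' -> mderiv (fun s => Y s + Z s) t (Y' + Z').
Proof.
move=> dY dZ i j; rewrite mxE; under [X in cderiv X]eq_fun do rewrite mxE.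
exact: cderivD.
Qed.

Lemma mderivZ m n (A : 'M[C]_(m, n)) (f : R -> C) t l : cderiv f t l ->
  mderiv (fun s => f s *: A) t (l *: A).
Proof.
move=> fl i j; rewrite mxE; under [X in cderiv X]eq_fun do rewrite mxE.
by apply: cderiv_eq (cderivM fl (cderiv_cst _ t)) _; rewrite mulr0 addr0.
Qed.

Lemma mderiv_mul m n k l (A : 'M[C]_(m, n)) (B : 'M[C]_(k, l)) Y t Z : mderiv Y t Z ->
  mderiv (fun s => A *m Y s *m B) t (A *m Z *m B).
Proof.
move=> YZ i j; rewrite mxE; under [X in cderiv X]eq_fun do rewrite mxE.
apply: cderiv_sum => a; rewrite mxE mulr_suml; under [X in cderiv X]eq_fun do rewrite mxE mulr_suml.
apply: cderiv_sum => c; apply: cderiv_eq (cderivM (cderivZ _ (YZ c a)) (cderiv_cst _ t)) _.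
by rewrite mulr0 addr0.
Qed.

Lemma mderiv_sum (I : Type) (r : seq I) m n (Y : I -> R -> 'M[C]_(m, n)) t Z :
  (forall i, mderiv (Y i) t (Z i)) ->
  mderiv (fun s => \sum_(i <- r) Y i s) t (\sum_(i <- r) Z i).
Proof.
move=> YZ i j; rewrite summxE; under [X in cderiv X]eq_fun do rewrite summxE.
by apply: cderiv_sum => k; exact: YZ.
Qed.

End SumNorm.

(** * Second-order estimate of a principal power near the identity matrix *)

Section MxPow.
Context {R : realType}.
Local Notation C := R[i].
Local Notation normc := (@Normc.normc R).

(* Here Y t = (1 + t E)^b.  The bound depends only on the differential equation,
   not on the conditioning of a Jordan basis. *)
Lemma ode_estimate N (b : R) : 0 <= b <= 1 -> exists c d : R, 0 < d /\
  forall (E : 'M[C]_N) (Y Z : R -> 'M[C]_N), sumnorm E <= d ->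
    (forall t : R, 0 <= t <= 1 -> mderiv Y t (Z t)) ->
    (forall t : R, 0 <= t <= 1 ->
       (1%:M + (t%:C)%C *: E) *m Z t = (b%:C)%C *: (E *m Y t)) ->
    Y 0 = 1%:M ->
    sumnorm (Y 1 - 1%:M - (b%:C)%C *: E) <= c * sumnorm E ^+ 2.
Proof.
move=> /andP[b0 b1]; pose k : R := 2 * (N * N)%:R; pose M : R := sumnorm (1%:M : 'M[C]_N).
have k0 : 0 <= k by rewrite mulr_ge0.
have M0 : 0 <= M by exact: sumnorm_ge0.
(* The radius is used twice. It gives [e <= 1/2], so that the term in [Z] on the right of [ZE] is
   absorbed, and [2 k e <= 1/2], so that the supremum [S] of the norm of [Y] is absorbed in its own
   bound [S <= M + 2 k e S]. *)
exists (k * ((4 * k + 4) * M)), (4 * k + 4)^-1.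
split=> [|E Y Z Ed YZ ode Y0]; first by rewrite invr_gt0; lra.
set e := sumnorm E in Ed *; have e0 : 0 <= e by exact: sumnorm_ge0.
have ek : e * (4 * k + 4) <= 1 by rewrite -ler_pdivlMr ?mul1r //; lra.
have ke : 0 <= k * e by rewrite mulr_ge0.
have ZE t : 0 <= t <= 1 -> Z t = (b%:C)%C *: (E *m Y t) - (t%:C)%C *: (E *m Z t).
  by move=> t01; rewrite -ode // mulmxDl mul1mx -scalemxAl addrK.
have sZ (a : R) : 0 <= a <= 1 -> forall X : 'M[C]_N,
    sumnorm ((a%:C)%C *: (E *m X)) <= e * sumnorm X.
  move=> /andP[a0 a1] X; rewrite sumnormZ normcR ger0_norm //.
  apply: le_trans _ (sumnormM _ _); rewrite -[leRHS]mul1r ler_wpM2r ?sumnorm_ge0 //.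
have nZ t : 0 <= t <= 1 -> sumnorm (Z t) <= 2 * e * sumnorm (Y t).
  move=> t01; have := sumnormB ((b%:C)%C *: (E *m Y t)) ((t%:C)%C *: (E *m Z t)).
  rewrite -ZE //; have := sZ b; rewrite b0 b1 => /(_ isT (Y t)); have := sZ t t01 (Z t).
  have := sumnorm_ge0 (Z t); have := sumnorm_ge0 (Y t).
  by move: (sumnorm (Z t)) (sumnorm (Y t)) => z y; nra.
pose S := sup [set sumnorm (Y t) | t in [set t : R | 0 <= t <= 1]].
have [B YB] := mderiv_bounded YZ.
have YS t : 0 <= t <= 1 -> sumnorm (Y t) <= S.
  move=> t01; apply: ub_le_sup; last by exists t.
  by exists B => _ [s s01 <-]; exact: YB.
have S0 : 0 <= S by apply: le_trans (sumnorm_ge0 _) (YS 0 _); rewrite lexx ler01.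
have Ydiff t : 0 <= t <= 1 -> sumnorm (Y t - 1%:M) <= k * (2 * e * S).
  move=> t01; rewrite -Y0; apply: (mderiv_mvt YZ) => // s s01.
  by apply: le_trans (nZ _ s01) _; rewrite ler_wpM2l ?YS // mulr_ge0.
have SM : S <= 2 * M.
  suff : S <= M + k * (2 * e * S) by nra.
  apply: ge_sup; first by exists (sumnorm (Y 0)), 0 => //=; rewrite lexx ler01.
  move=> _ [t t01 <-]; rewrite -{1}(subrK 1%:M (Y t)) addrC.
  by apply: le_trans (sumnormD _ _) _; rewrite lerD2l Ydiff.
(* [W] is [Y] without its linear term. Its derivative [b E (Y - 1) - t E Z] is of second order,
   since [Y - 1] and [Z] are of first order. *)
pose W t := Y t + (- t%:C)%C *: ((b%:C)%C *: E).
pose V t := Z t + (- 1) *: ((b%:C)%C *: E).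
have WV (t : R) : 0 <= t <= 1 -> mderiv W t (V t).
  move=> t01; apply: mderivD; first exact: YZ.
  apply: mderivZ; have := cderivZ (-1) (cderiv_id t).
  by rewrite mulr1; under eq_fun do rewrite mulN1r.
have VB (t : R) : 0 <= t <= 1 -> sumnorm (V t) <= (4 * k + 4) * M * e ^+ 2.
  move=> t01; rewrite /V scaleN1r ZE // addrAC.
  have -> : (b%:C)%C *: (E *m Y t) - (b%:C)%C *: E = (b%:C)%C *: (E *m (Y t - 1%:M)).
    by rewrite mulmxBr mulmx1 scalerBr.
  apply: le_trans (sumnormB _ _) _.
  have := sZ b; rewrite b0 b1 => /(_ isT (Y t - 1%:M)); have := sZ t t01 (Z t).
  have := Ydiff t t01; have := nZ t t01; have := YS t t01.
  move=> h1 h2 h3 h4 h5.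
  have hz : sumnorm (Z t) <= 2 * e * (2 * M).
    by apply: le_trans h2 _; rewrite ler_wpM2l ?mulr_ge0 // (le_trans h1).
  have hy : sumnorm (Y t - 1%:M) <= k * (2 * e * (2 * M)).
    by apply: le_trans h3 _; rewrite ler_wpM2l // ler_wpM2l // mulr_ge0.
  have hz' := ler_wpM2l e0 hz; have hy' := ler_wpM2l e0 hy.
  apply: le_trans (lerD h5 h4) _; apply: le_trans (lerD hy' hz') _.
  by rewrite le_eqVlt; apply/orP; left; apply/eqP; ring.
have := mderiv_mvt WV VB; move/(_ 1); rewrite ler01 lexx => /(_ isT).
rewrite /W Y0 oppr0 scale0r addr0 scaleN1r addrAC => H; apply: le_trans H _.
by rewrite le_eqVlt; apply/orP; left; apply/eqP; rewrite /k -/e; ring.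
Qed.

Lemma gbinomS (b : R) m : m.+1%:R * gbinom b m.+1 = (b - m%:R) * gbinom b m.
Proof.
rewrite /gbinom big_ord_recr /= factS natrM.
have : m.+1%:R != 0 :> R by rewrite pnatr_eq0.
have : m`!%:R != 0 :> R by rewrite pnatr_eq0 -lt0n fact_gt0.
by move=> f0 m0; field; rewrite f0 nat1r m0.
Qed.

(* The entry on the m-th superdiagonal of (1 + t (J - 1)) ^ b, for a Jordan
   block J of eigenvalue 1 + w, and its derivative in t. *)
Definition path_entry (b : R) (w : C) m (t : R) : C :=
  ((gbinom b m)%:C)%C * ((t%:C)%C ^+ m * hpow (1 + (t%:C)%C * w) (b - m%:R)).

Definition path_dentry (b : R) (w : C) m (t : R) : C :=
  ((gbinom b m)%:C)%C * (m%:R * (t%:C)%C ^+ m.-1 * 1 * hpow (1 + (t%:C)%C * w) (b - m%:R) +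
    (t%:C)%C ^+ m * (((b - m%:R)%:C)%C * w * hpow (1 + (t%:C)%C * w) (b - m%:R - 1))).

Lemma cderiv_path_entry b w m (t : R) : 0 < complex.Re (1 + (t%:C)%C * w) ->
  cderiv (path_entry b w m) t (path_dentry b w m t).
Proof.
move=> u0; apply: cderivZ; apply: cderivM; last exact: cderiv_hpow.
exact: cderivXn (cderiv_id t).
Qed.

Lemma path_ode0 (b : R) (w : C) (t : R) : 0 < complex.Re (1 + (t%:C)%C * w) ->
  (1 + (t%:C)%C * w) * path_dentry b w 0 t = (b%:C)%C * (w * path_entry b w 0 t).
Proof.
move=> u0; rewrite /path_dentry /path_entry subr0 !expr0 mul0r.
have -> : hpow (1 + (t%:C)%C * w) b = hpow (1 + (t%:C)%C * w) (b - 1) * (1 + (t%:C)%C * w).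
  by have := hpowD (b - 1) 1 u0; rewrite subrK (hpow1 u0).
by ring.
Qed.

(** The equation [(1 + t E) Y' = b E Y] on superdiagonal [m.+1] of a block, where the shift in [E]
    brings in superdiagonal [m]. Once a common power of [1 + t w] is factored out, it rests on the
    recursion [gbinomS]. *)
Lemma path_odeS (b : R) (w : C) m (t : R) : 0 < complex.Re (1 + (t%:C)%C * w) ->
  (1 + (t%:C)%C * w) * path_dentry b w m.+1 t + (t%:C)%C * path_dentry b w m t =
  (b%:C)%C * (w * path_entry b w m.+1 t + path_entry b w m t).
Proof.
move=> u0; rewrite /path_dentry /path_entry.
pose H := hpow (1 + (t%:C)%C * w) (b - m.+1%:R - 1).
set u := 1 + _ in u0 *.
have H1 : hpow u (b - m.+1%:R) = H * u.
  by have := hpowD (b - m.+1%:R - 1) 1 u0; rewrite subrK (hpow1 u0).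
have bm : b - m%:R = b - m.+1%:R + 1 by rewrite -natr1; ring.
have H2 : hpow u (b - m%:R) = H * u * u by rewrite bm (hpowD _ _ u0) (hpow1 u0) H1.
have H3 : hpow u (b - m%:R - 1) = H * u by rewrite bm addrK H1.
have G : m.+1%:R * ((gbinom b m.+1)%:C)%C = ((b - m%:R)%:C)%C * ((gbinom b m)%:C)%C.
  by rewrite -(rmorph_nat (real_complex R)) -!rmorphM gbinomS.
rewrite H1 H2 H3 -/H.
have Tm : (t%:C)%C * (m%:R * (t%:C)%C ^+ m.-1) = m%:R * (t%:C)%C ^+ m :> C.
  by case: (m) => [|k]; [rewrite !mul0r mulr0|rewrite [in RHS]exprS mulrCA].
move: G; rewrite !rmorphB !rmorph_nat /= exprS -!natr1.
move: Tm; move: H {H1 H2 H3} (gbinom b m)%:C%C (gbinom b m.+1)%:C%C (b%:C)%C.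
move: (t%:C)%C (_ ^+ m) (_ ^+ m.-1) u {u0} => T q q' u H g0 g1 B Tm G.
apply/eqP; rewrite -subr_eq0; apply/eqP.
(* The difference of both sides is this combination of the two vanishing differences supplied by [G]
   and [Tm]. *)
transitivity ((q * H * u ^+ 2 - T * q * w * H * u) * ((m%:R + 1) * g1 - (B - m%:R) * g0) +
  (T * (m%:R * q') - m%:R * q) * (g0 * H * u ^+ 2)); first by ring.
by rewrite G Tm !subrr mulr0 mul0r addr0.
Qed.

Definition block_path (b : R) (w : C) s t : 'M[C]_s :=
  \matrix_(i, j) if (i <= j)%N then path_entry b w (j - i) t else 0.

Definition block_dpath (b : R) (w : C) s t : 'M[C]_s :=
  \matrix_(i, j) if (i <= j)%N then path_dentry b w (j - i) t else 0.

Lemma mderiv_block_path b w s (t : R) : 0 < complex.Re (1 + (t%:C)%C * w) ->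
  mderiv (block_path b w s) t (block_dpath b w s t).
Proof.
move=> u0 i j; rewrite mxE; under [X in cderiv X]eq_fun do rewrite mxE.
by case: ifP => _; [exact: cderiv_path_entry|exact: cderiv_cst].
Qed.

Lemma block_path0 b w s : block_path b w s 0 = 1%:M.
Proof.
apply/matrixP => i j; rewrite !mxE /path_entry mul0r addr0 hpow_one mulr1 expr0n.
rewrite -val_eqE; case: (ltngtP i j) => [ij|ij|->] //=.
  by rewrite subn_eq0 leqNgt ij mulr0.
by rewrite subnn /gbinom big_ord0 fact0 divr1 mul1r.
Qed.

Lemma block_path1 b a s : 0 < complex.Re a ->
  block_path b (a - 1) s 1 = jordan_block_pow b s a.
Proof.
move=> a0; apply/matrixP => i j; rewrite !mxE; case: ifP => // _.
by rewrite /path_entry expr1n !mul1r [1 + _]addrC subrK cpowE.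
Qed.

Lemma block_ode b w s (t : R) : 0 < complex.Re (1 + (t%:C)%C * w) ->
  (1%:M + (t%:C)%C *: (w%:M + shift_mx C s)) *m block_dpath b w s t =
  (b%:C)%C *: ((w%:M + shift_mx C s) *m block_path b w s t).
Proof.
move=> u0; set T := (t%:C)%C.
have -> : 1%:M + T *: (w%:M + shift_mx C s) = (1 + T * w)%:M + T *: shift_mx C s.
  by rewrite scalerDr addrA scale_scalar_mx -raddfD.
rewrite !mulmxDl !mul_scalar_mx -scalemxAl; apply/matrixP => i j.
have sE c (X : 'M[C]_s) : (c *: X) i j = c * X i j by rewrite mxE.
rewrite [LHS]mxE !sE [in RHS]mxE !sE !shift_mulE.
case: insubP => [k _ ki|Hi].
  have {}ki : k = i.+1 :> nat by rewrite -ki.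
  rewrite !mxE ki; case: (ltngtP i j) => ij.
  - have -> : (j - i)%N = (j - i.+1).+1 by lia.
    by rewrite path_odeS.
  - by rewrite !mulr0 !addr0 mulr0.
  - by rewrite mulr0 !addr0 ij subnn path_ode0.
rewrite mulr0 !addr0 !mxE; have := ltn_ord j; move: Hi; rewrite -leqNgt => Hi ji.
case: (ltngtP i j) => ij; first by lia.
  by rewrite !mulr0.
by rewrite ij subnn path_ode0.
Qed.

Lemma jordan_blockE m (a : C) : jordan_block m a = a%:M + shift_mx C m.
Proof.
apply/matrixP => i j; rewrite !mxE; case: eqVneq => [->|_] /=.
  by rewrite gtn_eqF ?addr0.
by rewrite mulr0n add0r; case: eqP.
Qed.

(** Jordan forms exist over the complex numbers, so the choice in [mxpow] never falls back on its
    default. *)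
Lemma mxpowP b N (B : 'M[C]_N) : is_mxpow b B (mxpow b B).
Proof.
apply: (@xgetPex _ 0 [set X | is_mxpow b B X]).
have [q [lam [sz [P [Q [sz0 PQ QP BE]]]]]] := jordan_exists B.
exists (P *m (\mxdiag_(i < q) jordan_block_pow b (sz i) (lam i)) *m Q), q, lam, sz, P, Q.
by split=> //; rewrite BE; congr (_ *m _ *m _); apply: eq_mxdiag => i; rewrite jordan_blockE.
Qed.

(** Whichever decomposition [mxpow] has picked, conjugating the block paths by its basis gives a
    solution of the equation in [ode_estimate] that joins [1] to [mxpow b B]. *)
Lemma mxpow_estimate (b : R) N : 0 <= b <= 1 -> exists c d : R, 0 < d /\
  forall B : 'M[C]_N, sumnorm (B - 1%:M) <= d ->
    sumnorm (mxpow b B - 1%:M - (b%:C)%C *: (B - 1%:M)) <= c * sumnorm (B - 1%:M) ^+ 2.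
Proof.
move=> b01; have [c [d [d0 H]]] := ode_estimate N b01.
(* The bound 1/2 keeps [1 + t w] in the right half-plane for every eigenvalue [w] of [E], where the
   principal power is smooth. *)
exists c, (Num.min d (1 / 2)); split=> [|B].
  by rewrite lt_min d0; lra.
rewrite le_min; set E := B - 1%:M => /andP[Ed E12].
have [q [lam [sz [P [Q [sz0 PQ QP BE XE]]]]]] := mxpowP b B.
pose Pi i := submxrow P i; pose Qi i := submxcol Q i.
have PE : P = \mxrow_i Pi i by rewrite submxrowK.
have QE : Q = \mxcol_i Qi i by rewrite submxcolK.
have sumPQ F : P *m (\mxdiag_i F i) *m Q = \sum_i Pi i *m F i *m Qi i.
  by rewrite {1}PE {1}QE mul_mxrow_mxdiag mul_mxrow_mxcol.
have sum1 : \sum_i Pi i *m Qi i = 1%:M by rewrite -PQ PE QE mul_mxrow_mxcol.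
have QPi i : Qi i *m Pi i = 1%:M.
  have := QP; rewrite {1}PE {1}QE mul_mxcol_mxrow -mxdiagZ.
  by move=> /(congr1 (fun M => submxblock M i i)); rewrite mxblockK submxblock_diag.
pose w i := lam i - 1.
have EPi i : E *m Pi i = Pi i *m ((w i)%:M + shift_mx C (sz i)).
  have : B *m P = P *m (\mxdiag_(i < q) jordan_block (sz i) (lam i)).
    by rewrite BE -!mulmxA QP mulmx1.
  rewrite PE mul_mxrow_mxdiag mul_mxrow => /eq_mxrowP/(_ i).
  rewrite jordan_blockE /E mulmxBl mul1mx => ->.
  by rewrite /w raddfB /= -addrA (addrC (- _)) addrA mulmxBr mulmx1.
(* The first basis column of a block is an eigenvector of [E], so submultiplicativity bounds its
   eigenvalue. *)
have wE i : normc (w i) <= sumnorm E.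
  have [s sE] : exists s, sz i = s.+1 by case: (sz i) (sz0 i) => // s _; exists s.
  move: (QPi i) (EPi i); move: (Pi i) (Qi i); rewrite sE => p q' qp Ep.
  have p0 : col 0 p != 0.
    apply/eqP => p0; have := congr1 (fun M : 'M[C]_s.+1 => M 0 0) qp.
    rewrite [LHS]mxE !mxE eqxx big1 => [/eqP|k _]; first by rewrite eq_sym oner_eq0.
    by have /matrixP/(_ k 0) := p0; rewrite !mxE => ->; rewrite mulr0.
  have Ep0 : E *m col 0 p = w i *: col 0 p.
    have -> : E *m col 0 p = col 0 (E *m p) by rewrite !colE mulmxA.
    rewrite Ep mulmxDr mul_mx_scalar; apply/matrixP => k l.
    rewrite !mxE [X in _ + X]big1 ?addr0 // => r _.
    by rewrite mxE mulr0.
  have sp : 0 < sumnorm (col 0 p).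
    have [k [l kl]] := mx_neq0P p0; apply: lt_le_trans (sumnorm_ge _ k l).
    by rewrite lt_def normc_ge0 andbT; apply: contra_neq kl; exact: Normc.eq0_normc.
  by rewrite -(ler_pM2r sp) -sumnormZ -Ep0 sumnormM.
have upos (t : R) i : 0 <= t <= 1 -> 0 < complex.Re (1 + (t%:C)%C * w i).
  move=> /andP[t0 t1]; have := normRe_le (w i); have := wE i.
  case: (w i) => x y /= h1 h2; rewrite mul0r subr0.
  have : `|x| <= 1 / 2 by apply: le_trans h2 (le_trans h1 E12).
  by rewrite ler_norml => /andP[h3 _]; nra.
pose Y (t : R) := \sum_i Pi i *m block_path b (w i) (sz i) t *m Qi i.
pose Z (t : R) := \sum_i Pi i *m block_dpath b (w i) (sz i) t *m Qi i.
have Y1 : Y 1 = mxpow b B.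
  rewrite XE sumPQ; apply: eq_bigr => i _; rewrite block_path1 //.
  by have := upos 1 i; rewrite mul1r addrC subrK; apply; rewrite ler01 lexx.
rewrite -Y1; apply: (H E Y Z) => //.
- move=> t t01; apply: mderiv_sum => i; apply: mderiv_mul.
  by apply: mderiv_block_path; exact: upos.
- move=> t t01; rewrite /Z /Y !mulmx_sumr scaler_sumr; apply: eq_bigr => i _.
  have tEP : (1%:M + (t%:C)%C *: E) *m Pi i =
      Pi i *m (1%:M + (t%:C)%C *: ((w i)%:M + shift_mx C (sz i))).
    by rewrite mulmxDl mul1mx -scalemxAl EPi mulmxDr mulmx1 -scalemxAr.
  rewrite !mulmxA tEP -(mulmxA (Pi i)) block_ode ?upos // EPi.
  by rewrite -scalemxAr -scalemxAl !mulmxA.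
- by rewrite -sum1; apply: eq_bigr => i _; rewrite block_path0 mulmx1.
Qed.

End MxPow.

(** * Calculus of first-order expansions with quadratic remainder *)

Section QApprox.
Context {R : realType}.
Local Notation C := R[i].
Local Notation normc := (@Normc.normc R).
Implicit Types (f g : R -> C) (a b l m : C).

(* f e = a + e l + O(e^2) as e tends to 0. *)
Definition qapprox f a l : Prop := exists c d : R, [/\ 0 <= c, 0 < d <= 1 &
  forall e : R, `|e| <= d -> normc (f e - (a + (e%:C)%C * l)) <= c * e ^+ 2].

Lemma qapprox_lin a l : qapprox (fun e => a + (e%:C)%C * l) a l.
Proof.
exists 0, 1; split=> [||e _]; rewrite ?lexx ?ltr01 //.
by rewrite subrr Normc.normc0 mul0r.
Qed.

Lemma qapprox_cst a : qapprox (fun=> a) a 0.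
Proof.
exists 0, 1; split=> [||e _]; rewrite ?lexx ?ltr01 //.
by rewrite mulr0 addr0 subrr Normc.normc0 mul0r.
Qed.

Lemma qapproxD f g a b l m : qapprox f a l -> qapprox g b m ->
  qapprox (fun e => f e + g e) (a + b) (l + m).
Proof.
move=> [c [d [c0 /andP[d0 d1] fH]]] [c' [d' [c0' /andP[d0' d1'] gH]]].
exists (c + c'), (Num.min d d'); split=> [||e]; first exact: addr_ge0.
  by rewrite lt_min d0 d0' ge_min d1.
rewrite le_min => /andP[/fH fe /gH ge].
have -> : f e + g e - (a + b + (e%:C)%C * (l + m)) =
    (f e - (a + (e%:C)%C * l)) + (g e - (b + (e%:C)%C * m)) by ring.
by apply: le_trans (normcD _ _) _; rewrite mulrDl lerD.
Qed.

Lemma qapproxM f g a b l m : qapprox f a l -> qapprox g b m ->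
  qapprox (fun e => f e * g e) (a * b) (l * b + a * m).
Proof.
move=> [c [d [c0 /andP[d0 d1] fH]]] [c' [d' [c0' /andP[d0' d1'] gH]]].
(* For [|e| <= 1], [F] bounds the modulus of [f e] and [G] that of the affine part of [g]. *)
pose F := normc a + normc l + c; pose G := normc b + normc m.
have [a0 l0 b0 m0] : [/\ 0 <= normc a, 0 <= normc l, 0 <= normc b & 0 <= normc m].
  by split; exact: normc_ge0.
exists (F * c' + c * G + normc l * normc m), (Num.min d d'); split=> [||e].
- by rewrite !addr_ge0 ?mulr_ge0 ?addr_ge0.
- by rewrite lt_min d0 d0' ge_min d1.
rewrite le_min => /andP[ed ed']; have fe := fH e ed; have ge := gH e ed'.
have e1 : `|e| <= 1 by rewrite (le_trans ed).
have e2 : e ^+ 2 <= 1 by rewrite -real_normK ?num_real // expr_le1.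
have lin x y : normc (x + (e%:C)%C * y) <= normc x + normc y.
  apply: le_trans (normcD _ _) _; rewrite lerD2l Normc.normcM normcR.
  by rewrite -[leRHS]mul1r ler_wpM2r ?normc_ge0.
have fF : normc (f e) <= F.
  rewrite -[f e](subrKC (a + (e%:C)%C * l)).
  apply: le_trans (normcD _ _) _; rewrite /F; apply: lerD; first exact: lin.
  by apply: le_trans fe _; rewrite -[leRHS]mulr1 ler_wpM2l.
have -> : f e * g e - (a * b + (e%:C)%C * (l * b + a * m)) =
    f e * (g e - (b + (e%:C)%C * m)) + (f e - (a + (e%:C)%C * l)) * (b + (e%:C)%C * m) +
    (((e ^+ 2)%:C)%C * (l * m)) by rewrite rmorphXn /=; ring.
apply: le_trans (normcD _ _) _; rewrite [leRHS]mulrDl; apply: lerD; last first.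
  by rewrite !Normc.normcM normcR ger0_norm ?sqr_ge0 // mulrC.
apply: le_trans (normcD _ _) _; rewrite [leRHS]mulrDl; apply: lerD; rewrite Normc.normcM.
  by rewrite -mulrA ler_pM ?normc_ge0.
by rewrite mulrAC ler_pM ?normc_ge0 ?lin.
Qed.

Lemma qapprox_eq f a l a' l' : qapprox f a l -> a = a' -> l = l' -> qapprox f a' l'.
Proof. by move=> H <- <-. Qed.

Lemma qapproxZ f a l b : qapprox f a l -> qapprox (fun e => b * f e) (b * a) (b * l).
Proof.
move=> fl; apply: qapprox_eq (qapproxM (qapprox_cst b) fl) _ _ => //.
by rewrite mul0r add0r.
Qed.

Lemma qapprox_sum (I : Type) (r : seq I) (P : pred I) (f : I -> R -> C) (a l : I -> C) :
  (forall i, P i -> qapprox (f i) (a i) (l i)) ->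
  qapprox (fun e => \sum_(i <- r | P i) f i e) (\sum_(i <- r | P i) a i)
    (\sum_(i <- r | P i) l i).
Proof.
move=> H; elim: r => [|i r IH].
  rewrite !big_nil; under [X in qapprox X]eq_fun do rewrite big_nil.
  exact: qapprox_cst.
rewrite !big_cons; under [X in qapprox X]eq_fun do rewrite big_cons.
by case: ifPn => // Pi; apply: qapproxD => //; apply: H.
Qed.

Lemma qapprox_prod_seq (I : eqType) (r : seq I) (f : I -> R -> C) (a l : I -> C) :
  uniq r ->
  (forall i, qapprox (f i) (a i) (l i)) ->
  qapprox (fun e => \prod_(i <- r) f i e) (\prod_(i <- r) a i)
    (\sum_(i <- r) l i * \prod_(k <- r | i != k) a k).
Proof.
move=> + H; elim: r => [_|i r IH /= /andP[ir /IH{}IH]].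
  rewrite !big_nil; under [X in qapprox X]eq_fun do rewrite big_nil.
  exact: qapprox_cst.
under [X in qapprox X]eq_fun do rewrite big_cons.
apply: qapprox_eq (qapproxM (H i) IH) _ _; first by rewrite big_cons.
rewrite big_cons big_cons eqxx /=; congr (_ * _ + _).
  rewrite big_seq_cond [RHS]big_seq_cond; apply: eq_bigl => k.
  by rewrite andbT; case kr : (k \in r) => //=; apply/esym; apply: contraNneq ir => ->.
rewrite mulr_sumr [LHS]big_seq [RHS]big_seq; apply: eq_bigr => k kr.
rewrite big_cons mulrCA ifT //.
by apply: contraNneq ir => <-.
Qed.

Lemma qapprox_prod (I : finType) (f : I -> R -> C) (a l : I -> C) :
  (forall i, qapprox (f i) (a i) (l i)) ->
  qapprox (fun e => \prod_i f i e) (\prod_i a i) (\sum_i l i * \prod_(k | i != k) a k).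
Proof. by move=> H; apply: qapprox_prod_seq => //; exact: index_enum_uniq. Qed.

(** The product rule in the Leibniz formula; for each row [i], grouping the permutations by their
    value [j] at [i] produces the cofactors. *)
Lemma qapprox_det n (F : R -> 'M[C]_n) (A L : 'M[C]_n) :
  (forall i j, qapprox (fun e => F e i j) (A i j) (L i j)) ->
  qapprox (fun e => \det (F e)) (\det A) (\sum_i \sum_j L i j * cofactor A i j).
Proof.
move=> H; apply: qapprox_eq (qapprox_sum _ _) erefl _.
  by move=> s _; apply: qapproxZ; apply: qapprox_prod => i; exact: H.
rewrite (eq_bigr (fun s : 'S_n =>
  \sum_i L i (s i) * ((-1) ^+ s * \prod_(k | i != k) A k (s k)))).
  rewrite exchange_big; apply: eq_bigr => i _.
  rewrite (partition_big (fun s : 'S_n => s i) predT) //=; apply: eq_bigr => j _.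
  rewrite expand_cofactor mulr_sumr; apply: eq_big => [s|s /eqP <-] //.
by move=> s _; rewrite mulr_sumr; apply: eq_bigr => i _; rewrite mulrCA.
Qed.

Lemma derive1_quadratic (f : R -> R) (l c d : R) : 0 <= c -> 0 < d ->
  (forall e, `|e| <= d -> `|f e - (f 0 + e * l)| <= c * e ^+ 2) -> derive1 f 0 = l.
Proof.
move=> c0 d0 H; rewrite /derive1; apply: cvg_lim => //.
apply/cvgrPdist_le => eps eps0; near=> h.
have h0 : h != 0 by near: h; exact: nbhs_dnbhs_neq.
have hd : `|h| <= Num.min d (eps / (c + 1)).
  near: h; apply: dnbhs0_le; rewrite lt_min d0 divr_gt0 //; lra.
move: hd; rewrite le_min => /andP[/H Hh he].
rewrite addr0 distrC.
have -> : h^-1 *: (f h - f 0) - l = h^-1 * (f h - (f 0 + h * l)).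
  by rewrite /GRing.scale /=; field.
rewrite normrM normfV ler_pdivrMl ?normr_gt0 //.
apply: le_trans Hh _; rewrite -real_normK ?num_real // expr2 mulrCA ler_wpM2l //.
have : `|h| * (c + 1) <= eps by rewrite -ler_pdivlMr //; lra.
by have := normr_ge0 h; nra.
Unshelve. all: by end_near. Qed.

Lemma qapprox_at0 f a l : qapprox f a l -> f 0 = a.
Proof.
move=> [c [d [_ /andP[d0 _] /(_ 0)]]].
rewrite normr0 mul0r addr0 expr0n mulr0 => /(_ (ltW d0)) H.
apply/eqP; rewrite -subr_eq0; apply/eqP/Normc.eq0_normc/eqP.
by rewrite eq_le H normc_ge0.
Qed.

Lemma qapprox_derive f a l : qapprox f a l ->
  (derive1 (fun e => complex.Re (f e)) 0 +i* derive1 (fun e => complex.Im (f e)) 0)%C = l.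
Proof.
move=> fl; have f0 := qapprox_at0 fl; have [c [d [c0 /andP[d0 _] H]]] := fl.
rewrite (derive1_quadratic (l := complex.Re l) c0 d0).
  rewrite (derive1_quadratic (l := complex.Im l) c0 d0); first by case: (l).
  move=> e ed; apply: le_trans (H e ed); apply: le_trans _ (normIm_le _).
  by rewrite f0; case: (f e) (a) (l) => [? ?] [? ?] [? ?] /=; simpc.
move=> e ed; apply: le_trans (H e ed); apply: le_trans _ (normRe_le _).
by rewrite f0; case: (f e) (a) (l) => [? ?] [? ?] [? ?] /=; simpc.
Qed.

Lemma qapprox_mxderiv0 N (F : R -> 'M[C]_N) (A L : 'M[C]_N) :
  (forall i j, qapprox (fun e => F e i j) (A i j) (L i j)) -> mxderiv0 F = L.
Proof. by move=> H; apply/matrixP => i j; rewrite mxE (qapprox_derive (H i j)). Qed.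

Lemma qapprox_uniq f a l a' l' : qapprox f a l -> qapprox f a' l' -> l = l'.
Proof. by move=> /qapprox_derive <- /qapprox_derive <-. Qed.

Lemma qapprox_mx N (B : R -> 'M[C]_N) (A L : 'M[C]_N) :
  (forall i j, qapprox (fun e => B e i j) (A i j) (L i j)) ->
  exists c d : R, [/\ 0 <= c, 0 < d <= 1 &
    forall e : R, `|e| <= d -> sumnorm (B e - (A + (e%:C)%C *: L)) <= c * e ^+ 2].
Proof.
move=> H; pose c i j := sval (cid (H i j)).
have H1 i j : exists d : R, [/\ 0 <= c i j, 0 < d <= 1 & forall e : R, `|e| <= d ->
    normc (B e i j - (A i j + (e%:C)%C * L i j)) <= c i j * e ^+ 2].
  exact: (svalP (cid (H i j))).
pose d i j := sval (cid (H1 i j)).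
have H2 i j : [/\ 0 <= c i j, 0 < d i j <= 1 & forall e : R, `|e| <= d i j ->
    normc (B e i j - (A i j + (e%:C)%C * L i j)) <= c i j * e ^+ 2].
  exact: (svalP (cid (H1 i j))).
have d01 (x : 'I_N * 'I_N) : 0 <= d x.1 x.2 <= 1.
  by have [_ /andP[/ltW -> ->] _] := H2 x.1 x.2.
(* As every radius lies in ]0, 1], their product is a positive lower bound of all of them, for
   [N = 0] as well. *)
exists (\sum_i \sum_j c i j), (\prod_(x : 'I_N * 'I_N) d x.1 x.2); split.
- by rewrite sumr_ge0 // => i _; rewrite sumr_ge0 // => j _; have [] := H2 i j.
- apply/andP; split; last by apply: prodr_ile1 => x _; exact: d01.
  by rewrite prodr_gt0 // => x _; have [_ /andP[]] := H2 x.1 x.2.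
move=> e ed; rewrite mulr_suml; apply: ler_sum => i _; rewrite mulr_suml; apply: ler_sum => j _.
rewrite !mxE; have [_ _] := H2 i j; apply; apply: le_trans ed _.
rewrite (bigD1 (i, j)) //= -[leRHS]mulr1 ler_wpM2l //; first by have /andP[] := d01 (i, j).
by apply: prodr_ile1 => x _; exact: d01.
Qed.

(** Since [B e - 1] is [O(e)], the quadratic error of [mxpow_estimate] becomes [O(e^2)]; the radius
    [d / (K + 1)] keeps [B e] in the domain of that estimate. *)
Lemma qapprox_mxpow (b : R) N (B : R -> 'M[C]_N) (L : 'M[C]_N) : 0 <= b <= 1 ->
  (forall i j, qapprox (fun e => B e i j) ((1%:M : 'M[C]_N) i j) (L i j)) ->
  forall i j, qapprox (fun e => mxpow b (B e) i j) ((1%:M : 'M[C]_N) i j) ((b%:C)%C * L i j).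
Proof.
move=> b01 /qapprox_mx [k [dk [k0 /andP[dk0 dk1] H]]] i j.
have [c [d [d0 est]]] := mxpow_estimate N b01.
pose K := k + sumnorm L; have L0 : 0 <= sumnorm L by exact: sumnorm_ge0.
have K0 : 0 <= K by rewrite addr_ge0.
have BK e : `|e| <= dk -> sumnorm (B e - 1%:M) <= K * `|e|.
  move=> ed.
  have -> : B e - 1%:M = B e - (1%:M + (e%:C)%C *: L) + (e%:C)%C *: L.
    by rewrite opprD addrA subrK.
  apply: le_trans (sumnormD _ _) _; rewrite /K mulrDl; apply: lerD.
    apply: le_trans (H e ed) _; rewrite ler_wpM2l // -real_normK ?num_real // expr2.
    by rewrite -[leRHS]mulr1 ler_wpM2l // (le_trans ed).
  by rewrite sumnormZ normcR mulrC.
exists (`|c| * K ^+ 2 + k), (Num.min dk (d / (K + 1))); split.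
- by rewrite addr_ge0 // mulr_ge0 ?sqr_ge0.
- by rewrite lt_min dk0 ge_min dk1 divr_gt0 //; lra.
move=> e; rewrite le_min => /andP[ed]; rewrite ler_pdivlMr; last by lra.
move=> eK; have BKe := BK e ed.
have BD : sumnorm (B e - 1%:M) <= d.
  by apply: le_trans BKe _; have := normr_ge0 e; nra.
have := est _ BD; set X := mxpow b (B e) => XE.
have -> : X i j - ((1%:M : 'M[C]_N) i j + (e%:C)%C * ((b%:C)%C * L i j)) =
   (X - 1%:M - (b%:C)%C *: (B e - 1%:M)) i j +
   (b%:C)%C * (B e - (1%:M + (e%:C)%C *: L)) i j by rewrite !mxE; ring.
apply: le_trans (normcD _ _) _; rewrite [leRHS]mulrDl; apply: lerD.
  apply: le_trans (sumnorm_ge _ _ _) _; apply: le_trans XE _.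
  apply: (@le_trans _ _ (`|c| * sumnorm (B e - 1%:M) ^+ 2)).
    by rewrite ler_wpM2r ?sqr_ge0 // ler_norm.
  rewrite -mulrA ler_wpM2l // -(real_normK (num_real e)) -exprMn.
  by rewrite lerXn2r ?nnegrE ?sumnorm_ge0 // mulr_ge0.
rewrite Normc.normcM normcR; have /andP[b0 b1] := b01; rewrite ger0_norm //.
apply: le_trans (H e ed); rewrite -[leRHS]mul1r ler_pM ?normc_ge0 //.
exact: sumnorm_ge.
Qed.

End QApprox.

(** * Additive compounds *)

Section Indices.
Variable n : nat.

Lemma incr_tuplesP k (t : k.-tuple 'I_n) :
  reflect (forall a b : 'I_k, (a < b)%N -> (tnth t a < tnth t b)%N)
    ((t : k.-tuplelexi 'I_n) \in incr_tuples n k).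
Proof.
rewrite inE; apply: (iffP idP) => [st a b ab|H].
  have nthE (c : 'I_k) : nth 0%N (map val t) c = tnth t c.
    by rewrite (nth_map (tnth t c)) ?size_tuple // -tnth_nth.
  rewrite -!nthE; apply: (sorted_ltn_nth ltn_trans) => //;
    by rewrite inE size_map size_tuple.
apply/(sortedP 0%N) => i; rewrite size_map size_tuple => Hi.
have := H (Ordinal (ltnW Hi)) (Ordinal Hi) (ltnSn i).
have nthE (c : 'I_k) : nth 0%N (map val t) c = tnth t c.
  by rewrite (nth_map (tnth t c)) ?size_tuple // -tnth_nth.
by rewrite -!nthE.
Qed.

Lemma minor_index_incr k (I : 'I_#|incr_tuples n k|) (a b : 'I_k) : (a < b)%N ->
  (tnth (minor_index I) a < tnth (minor_index I) b)%N.
Proof. by move: a b; apply/incr_tuplesP; exact: Order.EnumVal.enum_valP. Qed.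

Lemma minor_index_inj k : injective (@minor_index n k).
Proof. exact: Order.EnumVal.enum_val_inj. Qed.

Lemma minor_index_tnth_inj k (I : 'I_#|incr_tuples n k|) : injective (tnth (minor_index I)).
Proof.
move=> a b E; apply/val_inj/eqP; case: ltngtP => // /(minor_index_incr I).
  by rewrite E ltnn.
by rewrite E ltnn.
Qed.

Lemma minor_index_eq_mem k (I J : 'I_#|incr_tuples n k|) :
  minor_index I =i minor_index J -> I = J.
Proof.
move=> IJ; apply: minor_index_inj; apply: val_inj; apply: (inj_map val_inj).
apply: (irr_sorted_eq ltn_trans ltnn).
- by have := Order.EnumVal.enum_valP I; rewrite inE.
- by have := Order.EnumVal.enum_valP J; rewrite inE.
move=> x; apply/mapP/mapP => -[y yI ->]; exists y => //.
  by rewrite -[_ \in _]IJ.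
by rewrite -[_ \in _]/(y \in minor_index I) IJ.
Qed.

Lemma remove_incr k (I : 'I_#|incr_tuples n k.+1|) (i : 'I_k.+1) :
  ([tuple tnth (minor_index I) (lift i j) | j < k] : k.-tuplelexi 'I_n) \in incr_tuples n k.
Proof.
apply/incr_tuplesP => a b ab; rewrite !tnth_mktuple; apply: minor_index_incr.
by rewrite /= /bump; lia.
Qed.

Definition remove_index k (I : 'I_#|incr_tuples n k.+1|) (i : 'I_k.+1) :
    'I_#|incr_tuples n k| :=
  Order.EnumVal.enum_rank_in (remove_incr I i)
    ([tuple tnth (minor_index I) (lift i j) | j < k] : k.-tuplelexi 'I_n).

Lemma remove_indexE k (I : 'I_#|incr_tuples n k.+1|) (i : 'I_k.+1) (j : 'I_k) :
  tnth (minor_index (remove_index I i)) j = tnth (minor_index I) (lift i j).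
Proof.
by rewrite /minor_index Order.EnumVal.enum_rankK_in ?remove_incr // tnth_mktuple.
Qed.

(** The distinctness of the pairs [(I_c, I minus I_c)]: the removed element and the remaining ones
    together give back the set, and then the position. *)
Lemma remove_index_inj k (I J : 'I_#|incr_tuples n k.+1|) i j :
  tnth (minor_index I) i = tnth (minor_index J) j ->
  remove_index I i = remove_index J j -> I = J /\ i = j.
Proof.
move=> Ei Er.
have El l : tnth (minor_index I) (lift i l) = tnth (minor_index J) (lift j l).
  by rewrite -!remove_indexE Er.
have IJ : I = J.
  apply: minor_index_eq_mem => x; apply/tnthP/tnthP => -[a ->].
    by case: (unliftP i a) => [l ->|->]; [exists (lift j l)|exists j].
  by case: (unliftP j a) => [l ->|->]; [exists (lift i l)|exists i].
by split=> //; move: Ei; rewrite IJ => /minor_index_tnth_inj.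
Qed.

Lemma card_incr_tuples_gt0 k : (k <= n)%N -> (0 < #|incr_tuples n k|)%N.
Proof.
move=> kn; apply/card_gt0P; exists ([tuple widen_ord kn i | i < k] : k.-tuplelexi 'I_n).
by apply/incr_tuplesP => a b; rewrite !tnth_mktuple.
Qed.
End Indices.

Section Additive.
Context {R : realType} (n : nat).
Local Notation C := R[i].
Local Notation normc := (@Normc.normc R).

Definition sub_id k (I J : 'I_#|incr_tuples n k|) : 'M[C]_k :=
  mxsub (tnth (minor_index I)) (tnth (minor_index J)) 1%:M.

(* Jacobi's formula for the derivative of the minors of 1 + e A at e = 0. *)
Definition kadd k (A : 'M[C]_n) : 'M[C]_#|incr_tuples n k| :=
  \matrix_(I, J) \sum_i \sum_j
    A (tnth (minor_index I) i) (tnth (minor_index J) j) * cofactor (sub_id I J) i j.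

Lemma qapprox_perturb (A : 'M[C]_n) i j :
  qapprox (fun e => perturb A e i j) ((1%:M : 'M[C]_n) i j) (A i j).
Proof.
under [X in qapprox X]eq_fun do rewrite [perturb _ _ _ _]mxE [X in _ + X]mxE.
exact: qapprox_lin.
Qed.

Lemma qapprox_compound k (A : 'M[C]_n) I J :
  qapprox (fun e => compound k (perturb A e) I J) (compound k 1%:M I J) (kadd k A I J).
Proof.
under [X in qapprox X]eq_fun do rewrite [compound _ _ _ _]mxE.
rewrite [compound _ _ _ _]mxE [kadd _ _ _ _]mxE.
have := @qapprox_det R k
  (fun e => mxsub (tnth (minor_index I)) (tnth (minor_index J)) (perturb A e))
  (sub_id I J) (mxsub (tnth (minor_index I)) (tnth (minor_index J)) A).
move=> /(_ _)/qapprox_eq; apply => // [i j|].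
  rewrite mxE [X in qapprox _ _ X]mxE.
  under [X in qapprox X]eq_fun do rewrite [mxsub _ _ _ _ _]mxE.
  exact: qapprox_perturb.
by apply: eq_bigr => i _; apply: eq_bigr => j _; rewrite mxE.
Qed.

(** For distinct [I] and [J] of equal size, some element of [I] is missing from [J], and the minor
    has a zero row. *)
Lemma compound1 k : compound k (1%:M : 'M[C]_n) = 1%:M.
Proof.
apply/matrixP => I J; rewrite [LHS]mxE [RHS]mxE.
have [<-|nIJ] := eqVneq I J.
  rewrite (_ : mxsub _ _ _ = 1%:M) ?det1 //; apply/matrixP => a b.
  by rewrite !mxE (inj_eq (@minor_index_tnth_inj _ _ I)).
have [a Ha] : exists a, tnth (minor_index I) a \notin minor_index J.
  apply/existsP; apply: contraNT nIJ => /existsPn H; apply/eqP/minor_index_eq_mem.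
  have uI : uniq (minor_index I).
    have -> : minor_index I = map (tnth (minor_index I)) (enum 'I_k) :> seq _.
      by rewrite map_tnth_enum.
    by rewrite map_inj_uniq ?enum_uniq //; exact: minor_index_tnth_inj.
  have sIJ : {subset minor_index I <= minor_index J} by move=> x /tnthP[a ->]; exact/negPn/H.
  by apply: (uniq_min_size uI sIJ _).2; rewrite !size_tuple.
rewrite (expand_det_row _ a) big1 // => j _; rewrite !mxE.
case: eqP => [E|]; last by rewrite mul0r.
by rewrite E mem_tnth in Ha.
Qed.

Lemma mxderiv0_compound k (A : 'M[C]_n) :
  mxderiv0 (fun e => compound k (perturb A e)) = kadd k A.
Proof. by apply: qapprox_mxderiv0 => I J; exact: qapprox_compound. Qed.

(* The product rule in the sum over all rows of the Laplace expansions of a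
   minor: by Jacobi's formula, the terms where the entry is differentiated add
   up to the derivative of the minor itself. *)
Lemma kadd_laplace k (A : 'M[C]_n) I J :
  k%:R * kadd k.+1 A I J = \sum_i \sum_j
    ((tnth (minor_index I) i == tnth (minor_index J) j)%:R * (-1) ^+ (i + j)) *
    kadd k A (remove_index I i) (remove_index J j).
Proof.
pose M e := mxsub (tnth (minor_index I)) (tnth (minor_index J)) (perturb A e).
have cofE (X : 'M[C]_n) i j :
    cofactor (mxsub (tnth (minor_index I)) (tnth (minor_index J)) X) i j =
    (-1) ^+ (i + j) * compound k X (remove_index I i) (remove_index J j).
  rewrite /cofactor [compound _ _ _ _]mxE; congr (_ * \det _).
  by apply/matrixP => a b; rewrite !mxE !remove_indexE.
have lap e : k.+1%:R * compound k.+1 (perturb A e) I J =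
    \sum_i \sum_j perturb A e (tnth (minor_index I) i) (tnth (minor_index J) j) *
      ((-1) ^+ (i + j) * compound k (perturb A e) (remove_index I i) (remove_index J j)).
  rewrite [compound _ _ _ _]mxE -/(M e) (eq_bigr (fun=> \det (M e))) => [|i _].
    by rewrite sumr_const card_ord mulr_natl.
  rewrite (expand_det_row _ i); apply: eq_bigr => j _.
  by rewrite cofE [M _ _ _]mxE.
have d1 := qapproxZ (k.+1%:R) (qapprox_compound A I J).
have d2 : qapprox (fun e => k.+1%:R * compound k.+1 (perturb A e) I J)
    (\sum_i \sum_j (1%:M : 'M[C]_n) (tnth (minor_index I) i) (tnth (minor_index J) j) *
      ((-1) ^+ (i + j) * compound k 1%:M (remove_index I i) (remove_index J j)))
    (\sum_i \sum_j (A (tnth (minor_index I) i) (tnth (minor_index J) j) *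
      ((-1) ^+ (i + j) * compound k 1%:M (remove_index I i) (remove_index J j)) +
      (1%:M : 'M[C]_n) (tnth (minor_index I) i) (tnth (minor_index J) j) *
      ((-1) ^+ (i + j) * kadd k A (remove_index I i) (remove_index J j)))).
  under [X in qapprox X]eq_fun do rewrite lap.
  apply: qapprox_sum => i _; apply: qapprox_sum => j _.
  apply: qapproxM; first exact: qapprox_perturb.
  by apply: qapproxZ; exact: qapprox_compound.
have := qapprox_uniq d1 d2.
under eq_bigr do rewrite big_split /=.
rewrite big_split /= => H; move: H.
have -> : \sum_i \sum_j A (tnth (minor_index I) i) (tnth (minor_index J) j) *
      ((-1) ^+ (i + j) * compound k 1%:M (remove_index I i) (remove_index J j)) =
    kadd k.+1 A I J.
  rewrite [RHS]mxE; apply: eq_bigr => i _; apply: eq_bigr => j _.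
  by rewrite /sub_id cofE.
(* The differentiated entries make up one copy of [kadd k.+1 A I J]; cancelling it leaves [k]
   copies. *)
rewrite -natr1 mulrDl mul1r [LHS]addrC => H; rewrite (addrI _ H).
by apply: eq_bigr => i _; apply: eq_bigr => j _; rewrite mxE mulrA.
Qed.

Lemma mxderiv0_frac_compound k (s : R) (A : 'M[C]_n) : 0 <= s <= 1 ->
  mxderiv0 (fun e => frac_compound k s (perturb A e)) =
  kron (((1 - s)%:C)%C *: kadd k A) 1%:M + kron 1%:M ((s%:C)%C *: kadd k.+1 A).
Proof.
move=> s01; have s01' : 0 <= 1 - s <= 1 by lra.
have q1 j (b : R) : 0 <= b <= 1 -> forall I J,
    qapprox (fun e => mxpow b (compound j (perturb A e)) I J)
      ((1%:M : 'M[C]__) I J) ((b%:C)%C * kadd j A I J).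
  by move=> b01; apply: qapprox_mxpow => // I J; rewrite -compound1; exact: qapprox_compound.
apply: (@qapprox_mxderiv0 _ _ _ (kron 1%:M 1%:M)) => r c; rewrite mxE.
under [X in qapprox X]eq_fun do rewrite mxE.
apply: qapprox_eq (qapproxM (q1 k _ s01' _ _) (q1 k.+1 _ s01 _ _)) _ _ => //.
by rewrite !mxE.
Qed.

End Additive.

(** * Norm comparison between consecutive additive compounds *)

Section Monotone.
Context {R : realType} (n : nat) (p : \bar R).
Hypothesis p1 : (1%:E <= p)%E.
Local Notation C := R[i].
Local Notation normc := (@Normc.normc R).

Lemma normc_sign (c : nat) (z : C) : normc ((-1) ^+ c * z) = normc z.
Proof. by rewrite -signr_odd; case: (odd c); rewrite ?expr1 ?mulN1r ?normcN ?mul1r. Qed.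

(** The factor comes from [C^T C = k + 1]: with the Laplace identity, [C^T (1 (x) (1 + e A^[k])) C]
    is [(k + 1) (1 + e k/(k+1) A^[k+1])]. *)
Lemma mxnorm_kadd_succ k (A : 'M[C]_n) (e : R) : (k < n)%N ->
  mxnorm p (perturb (((k%:R / k.+1%:R)%:C)%C *: kadd k.+1 A) e) <=
  mxnorm p (perturb (kadd k A) e).
Proof.
move=> kn; set X := perturb (kadd k A) e; apply: (mxnorm_le p1) => [|v].
  exact: card_incr_tuples_gt0.
set y := _ *m v.
pose iota (x : 'I_#|incr_tuples n k.+1| * 'I_k.+1) :=
  (tnth (minor_index x.1) x.2, remove_index x.1 x.2).
have iotaI : injective iota.
  by move=> [I c] [J d] [E1 E2]; have [-> ->] := remove_index_inj E1 E2.
(* [w] is [C v] as a family on pairs; [W a] is its slice at [a], on which [1 (x) X] acts as [X]. *)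
pose w x := \sum_z (iota z == x)%:R * ((-1) ^+ (z.2 : 'I_k.+1) * v z.1 0).
have wE I c : w (iota (I, c)) = (-1) ^+ c * v I 0.
  rewrite /w (bigD1 (I, c)) //= eqxx mul1r big1 ?addr0 // => z nz.
  by rewrite (inj_eq iotaI) (negPf nz) mul0r.
have w0 x : x \notin codom iota -> w x = 0.
  move=> xn; rewrite /w big1 // => z _; case: eqP => [E|]; last by rewrite mul0r.
  by rewrite -E codom_f in xn.
pose W a : 'cV[C]_#|incr_tuples n k| := \col_K w (a, K).
pose z (x : 'I_n * 'I_#|incr_tuples n k|) : R := normc ((X *m W x.1) x.2 0).
(* The identity [(k + 1) y = C^T (1 (x) X) C v] at the coordinate [I]. *)
have yE I : k.+1%:R * y I 0 = \sum_(c < k.+1) (-1) ^+ c *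
    (X *m W (tnth (minor_index I) c)) (remove_index I c) 0.
  have mulE m (B : 'M[C]_m) (u : 'cV_m) i :
      (perturb B e *m u) i 0 = u i 0 + (e%:C)%C * \sum_j B i j * u j 0.
    rewrite mulmxDl mul1mx -scalemxAl mxE; congr (_ + _).
    by rewrite mxE mxE.
  have AW a r : \sum_K kadd k A r K * W a K 0 =
      \sum_J \sum_d (tnth (minor_index J) d == a)%:R *
        ((-1) ^+ d * kadd k A r (remove_index J d)) * v J 0.
    rewrite pair_bigA /= (eq_bigr (fun K => \sum_z kadd k A r K *
        ((iota z == (a, K))%:R * ((-1) ^+ z.2 * v z.1 0)))) => [|K _]; last first.
      by rewrite [W _ _ _]mxE mulr_sumr.
    rewrite exchange_big; apply: eq_bigr => -[J d] _ /=.
    rewrite (bigD1 (remove_index J d)) //= big1 ?addr0 => [|K nK].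
      by rewrite xpair_eqE eqxx andbT; ring.
    by rewrite xpair_eqE eq_sym in nK *; rewrite eq_sym (negPf nK) andbF mul0r mulr0.
  rewrite mulE (eq_bigr (fun c : 'I_k.+1 => v I 0 + (e%:C)%C * ((-1) ^+ c *
      \sum_K kadd k A (remove_index I c) K * W (tnth (minor_index I) c) K 0))) => [|c _]; last first.
    rewrite mulE [W _ _ _]mxE -[(_, _)]/(iota (I, c)) wE mulrDr signrMK.
    by congr (_ + _); rewrite mulrCA.
  rewrite big_split /= sumr_const card_ord mulrDr mulr_natl; congr (_ + _).
  rewrite -mulr_sumr mulrCA; congr (_ * _); rewrite mulr_sumr.
  transitivity (\sum_J (k%:R * kadd k.+1 A I J) * v J 0).
    apply: eq_bigr => J _; rewrite mxE mulrA mulrA; congr (_ * _ * _).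
    rewrite -(rmorph_nat (real_complex R)) -rmorphM /= mulrC divfK ?pnatr_eq0 //.
    by rewrite -[RHS](rmorph_nat (real_complex R)).
  under eq_bigr do rewrite kadd_laplace mulr_suml.
  rewrite exchange_big; apply: eq_bigr => c _; rewrite AW mulr_sumr.
  apply: eq_bigr => J _; rewrite mulr_suml mulr_sumr; apply: eq_bigr => d _.
  by rewrite exprD eq_sym; ring.
(* This is [(k + 1)^(1/p)], written as a norm so that finite and infinite [p] are treated alike. *)
pose K1 : R := pnorm p (fun _ : 'I_k.+1 => 1).
have K10 : 0 < K1 by apply: lt_le_trans (pnorm_ge p1 ord0 _) => //; exact: ltr01.
have z0 x : 0 <= z x by exact: normc_ge0.
rewrite -(ler_pM2l K10) mulrCA.
apply: (@le_trans _ _ (pnorm p (fun I => pnorm p (fun c => z (iota (I, c)))))).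
  rewrite -[vnorm p y]/(pnorm p (fun I => normc (y I 0))).
  rewrite -(pnormZ p1) ?pnorm_ge0 // => [|I]; last exact: normc_ge0.
  apply: (le_pnorm p1) => I; first by rewrite mulr_ge0 ?normc_ge0 ?pnorm_ge0.
  (* By [yE] the modulus of [y I 0] is at most the mean of the [z (iota (I, c))] over [c], and a
     constant family on [k + 1] indices has [K1] times its value as norm. *)
  apply: le_trans (pnorm_mean p1 _) => [|c]; last exact: z0.
  rewrite mulrC -(pnormZ p1) ?normc_ge0 //.
  apply: (le_pnorm p1) => [c|c]; rewrite mulr1 ?normc_ge0 //.
  rewrite -ler_pdivrMl ?invr_gt0 ?ltr0Sn // invrK.
  rewrite -[k.+1%:R]normc_nat -Normc.normcM yE (le_trans (normc_sum _ _ _)) //.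
  by apply: ler_sum => c' _; rewrite normc_sign.
rewrite -(pnorm_pair p1 (z := fun x => z (iota x))) //.
apply: le_trans (le_pnorm_inj p1 iotaI z0) _; rewrite (pnorm_pair p1) //.
apply: (@le_trans _ _ (mxnorm p X * pnorm p (fun a => vnorm p (W a)))).
  rewrite -(pnormZ p1) ?mxnorm_ge0 // => [|a]; last exact: vnorm_ge0.
  apply: (le_pnorm p1) => a; first exact: pnorm_ge0.
  exact: (@vnorm_mul _ p p1 _ X (W a)).
rewrite ler_wpM2l ?mxnorm_ge0 // le_eqVlt; apply/orP; left; apply/eqP.
(* [w] is supported on the range of [iota], where each modulus of an entry of [v] occurs [k + 1]
   times, so its norm is [K1] times that of [v]. *)
transitivity (pnorm p (fun x => normc (w x))).
  rewrite (pnorm_pair p1) => [|x]; last exact: normc_ge0.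
  by apply: eq_pnorm => a; apply: eq_pnorm => K; rewrite mxE.
rewrite (pnorm_inj p1 iotaI) => [|x|x /w0 ->]; rewrite ?normc_ge0 ?Normc.normc0 //.
rewrite (pnorm_pair p1) => [|x]; last exact: normc_ge0.
rewrite -(pnormZ p1) ?pnorm_ge0 // => [|I]; last exact: normc_ge0.
apply: eq_pnorm => I; rewrite mulrC -(pnormZ p1) ?normc_ge0 //.
by apply: eq_pnorm => c; rewrite [iota]lock /= -lock wE normc_sign mulr1.
Qed.

End Monotone.

(** * Measures of additive compounds of real order *)

Section Measures.
Context {R : realType} (n : nat) (p : \bar R).
Hypothesis p1 : (1%:E <= p)%E.
Local Notation C := R[i].

Lemma mxmeasure_kadd_succ k (A : 'M[C]_n) : (0 < k < n)%N ->
  k%:R * mxmeasure p (kadd k.+1 A) <= k.+1%:R * mxmeasure p (kadd k A).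
Proof.
move=> /andP[k0 kn]; have kR : 0 < k%:R :> R by rewrite ltr0n.
have -> : k%:R = k.+1%:R * (k%:R / k.+1%:R) :> R by rewrite mulrC divfK ?pnatr_eq0.
rewrite -mulrA ler_wpM2l // -mxmeasureZ ?card_incr_tuples_gt0 ?divr_gt0 ?ltr0Sn //.
apply: le_mxmeasure; rewrite ?card_incr_tuples_gt0 ?(ltnW kn) // => e _.
exact: mxnorm_kadd_succ.
Qed.

Lemma mxmeasure_add_compound (alpha : R) (A : 'M[C]_n) : 1 <= alpha <= n%:R ->
  let k := Num.truncn alpha in let s := alpha - k%:R in
  mxmeasure p (projT2 (add_compound alpha A)) =
  (1 - s) * mxmeasure p (kadd k A) + s * mxmeasure p (kadd k.+1 A).
Proof.
move=> /andP[a1 an] k s; rewrite /add_compound -/k -/s.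
have /andP[ka ak] : k%:R <= alpha < k.+1%:R by apply: truncn_itv; lra.
(* For integer [alpha] the second term has weight 0; at [alpha = n] it even refers to an empty
   matrix. *)
have [s0|s0] := eqVneq s 0; rewrite /=.
  by rewrite mxderiv0_compound s0 subr0 mul1r mul0r addr0.
have sp : 0 < s by rewrite lt_def s0 subr_ge0.
have s1 : s < 1 by rewrite /s; move: ak; rewrite -natr1; lra.
have kn : (k < n)%N by rewrite -(ltr_nat R); move: sp; rewrite /s; lra.
rewrite mxderiv0_frac_compound ?ltW //= mxmeasure_kron_sum ?card_incr_tuples_gt0 ?(ltnW kn) //.
by rewrite !mxmeasureZ ?card_incr_tuples_gt0 ?(ltnW kn) // subr_gt0.
Qed.

Lemma mxmeasure_kadd_star (A : 'M[C]_n) j k : (0 < j)%N -> (j <= k <= n)%N ->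
  mxmeasure p (kadd k A) / k%:R <= mxmeasure p (kadd j A) / j%:R.
Proof.
move=> j0 /andP[jk kn]; elim: k jk kn => [|k IH]; first by case: j j0.
rewrite leq_eqVlt => /orP[/eqP <- //|]; rewrite ltnS => jk kn.
have k0 : (0 < k)%N by exact: leq_trans jk.
apply: le_trans (IH jk (ltnW kn)); rewrite ler_pdivrMr ?ltr0Sn // mulrAC ler_pdivlMr ?ltr0n //.
by rewrite mulrC [leRHS]mulrC mxmeasure_kadd_succ // k0.
Qed.

Lemma mxmeasure_add_compound_star (alpha beta : R) (A : 'M[C]_n) :
  1 <= alpha -> alpha < beta <= n%:R ->
  alpha * mxmeasure p (projT2 (add_compound beta A)) <=
  beta * mxmeasure p (projT2 (add_compound alpha A)).
Proof.
move=> a1 /andP[ab bn]; rewrite !mxmeasure_add_compound; [|by lra|by lra].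
set k := Num.truncn alpha; set l := Num.truncn beta.
have /andP[ka ak] : k%:R <= alpha < k.+1%:R by apply: truncn_itv; lra.
have /andP[lb bl] : l%:R <= beta < l.+1%:R by apply: truncn_itv; lra.
have k0 : (0 < k)%N by rewrite -(ltr_nat R); move: ak; rewrite -natr1; lra.
have kl : (k <= l)%N by rewrite -ltnS -(ltr_nat R); lra.
have kn : (k < n)%N by rewrite -(ltr_nat R); lra.
have ln : (l <= n)%N by rewrite -(ler_nat R); lra.
set s := alpha - k%:R; set t := beta - l%:R.
pose h j := mxmeasure p (kadd j A) / j%:R.
have gE j : (0 < j)%N -> mxmeasure p (kadd j A) = j%:R * h j.
  by move=> j0; rewrite /h mulrC divfK // pnatr_eq0 -lt0n.
rewrite !gE ?(leq_trans k0 kl) //.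
have hk : h k.+1 <= h k by apply: mxmeasure_kadd_star => //; rewrite leqnSn.
have k0R : 0 < k%:R :> R by rewrite ltr0n.
have sE : alpha = k%:R + s by rewrite /s; ring.
have tE : beta = l%:R + t by rewrite /t; ring.
have s01 : 0 <= s < 1 by rewrite /s; move: ak; rewrite -natr1; lra.
have t01 : 0 <= t < 1 by rewrite /t; move: bl; rewrite -natr1; lra.
(* If both orders lie in one unit interval, the difference of the two sides is an explicit multiple
   of [h k - h k.+1]. Otherwise both sides are compared with [alpha * beta * h k.+1], taken at an
   integer between the two orders. *)
case: (ltngtP k l) kl => // [kl _|kl _]; last first.
  rewrite -kl in tE t01 *.
  rewrite -subr_ge0.
  have -> : beta * ((1 - s) * (k%:R * h k) + s * (k.+1%:R * h k.+1)) -
    alpha * ((1 - t) * (k%:R * h k) + t * (k.+1%:R * h k.+1)) =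
    k.+1%:R * k%:R * (beta - alpha) * (h k - h k.+1).
    by rewrite sE tE -natr1; ring.
  by rewrite !mulr_ge0 // ?subr_ge0 // ltW.
have hl : h l <= h k.+1 by apply: mxmeasure_kadd_star => //; rewrite kl.
(* The case [t = 0] is separate because [l.+1] may then exceed [n]. *)
have hl1 : t * (l.+1%:R * h l.+1) <= t * (l.+1%:R * h l).
  have [->|t0] := eqVneq t 0; first by rewrite !mul0r.
  have tp : 0 < t by rewrite lt_def t0; lra.
  have ln' : (l < n)%N by rewrite -(ltr_nat R); move: tp; rewrite /t; lra.
  apply: ler_wpM2l; first exact: ltW.
  apply: ler_wpM2l => //; apply: mxmeasure_kadd_star => //.
    exact: leq_trans kl.
  by rewrite leqnSn.
apply: (@le_trans _ _ (alpha * (beta * h k.+1))).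
  apply: ler_wpM2l; first by lra.
  apply: le_trans (lerD (lexx _) hl1) _.
  have -> : (1 - t) * (l%:R * h l) + t * (l.+1%:R * h l) = beta * h l.
    by rewrite tE -natr1; ring.
  by apply: ler_wpM2l => //; lra.
rewrite mulrCA; apply: ler_wpM2l; first by lra.
have -> : alpha * h k.+1 = (1 - s) * (k%:R * h k.+1) + s * (k.+1%:R * h k.+1).
  by rewrite sE -natr1; ring.
by rewrite lerD2r; apply: ler_wpM2l; [lra|exact: ler_wpM2l].
Qed.

End Measures.

Theorem corollary5 (R : realType) (n : nat)
    (f : R -> 'cV[R]_n -> 'cV[R]_n) (D : set 'cV[R]_n)
    (f_C1 : C1_system f D) (D_inv : invariant_set f D)
    (p : \bar R) (hp : p = 1%:E \/ p = 2%:E \/ p = +oo%E)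
    (alpha : R) (halpha : 1 <= alpha < n%:R)
    (hcontr : exists2 eta : R, 0 < eta &
       forall (t : R) (x : 'cV[R]_n), 0 <= t -> D x ->
         measure_Jac_compound f p alpha t x <= - eta) :
  exists astar : R,
    [/\ 1 <= astar <= alpha,
        (forall beta : R, astar < beta <= n%:R -> contracting f D p beta) &
        (forall a : R, 1 <= a <= alpha ->
           (forall beta : R, a < beta <= n%:R -> contracting f D p beta) ->
           astar <= a)].
Proof.
have p1 : (1%:E <= p)%E.
  by case: hp => [->|[->|->]]; rewrite ?leey // lee_fin ?ler1n.
move: halpha => /andP[a1 an].
pose S := [set a : R | 1 <= a <= alpha /\
  forall beta : R, a < beta <= n%:R -> contracting f D p beta].
have Salpha : S alpha.
  split=> [|beta bn]; first by rewrite a1 lexx.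
  (* The same [eta] serves: [alpha mu_beta <= beta mu_alpha <= - beta eta], and
     [beta > alpha > 0]. *)
  have /andP[ab _] := bn; have [eta eta0 H] := hcontr; exists eta => // t x t0 Dx.
  have := mxmeasure_add_compound_star p1 (map_mx (real_complex R) (Jac f t x)) a1 bn.
  have := H t x t0 Dx; rewrite /measure_Jac_compound.
  move: (mxmeasure _ _) (mxmeasure _ _) => u v; nra.
have Slb : has_lbound S by exists 1 => a [/andP[]].
exists (inf S); split.
- rewrite lb_le_inf //=; [|by exists alpha|by move=> a [/andP[]]].
  exact: ge_inf.
(* The condition concerns only orders strictly above the threshold, and an order above the infimum
   is above some member of [S]. *)
- move=> beta /andP[Sb bn].
  have [a [_ Sa] ab] : exists2 a, S a & a < beta by apply: inf_lt => //; exists alpha.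
  by apply: Sa; rewrite ab.
- by move=> a a1' Ha; apply: ge_inf.
Qed.
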